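(* Let $\mathcal{H}$ be a complex separable Hilbert space, $A\in\mathcal{B}(\mathcal{H})$, and $\mathcal{G}\subset\mathcal{H}$ a countable Bessel system. Assume the semigroup $\{e^{tA}\}_{t\ge0}$ is exponentially stable. Then the following are equivalent: (i) $\{e^{tA}g\}_{g\in\mathcal{G},\,t\in[0,\infty)}$ is a semi-continuous frame for $\mathcal{H}$. (ii) There exists $\delta>0$ such that for every uniformly separated countable set $T=\{t_j:j\in\mathbb{N}\}\subset[0,\infty)$ with $t_1=0$ and $0<t_{j+1}-t_j<\delta$ for all $j\in\mathbb{N}$, the system $\{e^{tA}g\}_{g\in\mathcal{G},\,t\in T}$ is a frame for $\mathcal{H}$. (iii) There exists $m>0$ such that, with $T=\{jm: j=0,1,2,\dots\}$, the system $\{e^{tA}g\}_{g\in\mathcal{G},\,t\in T}$ is a frame for $\mathcal{H}$.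
   Context: For $A\in\mathcal{B}(\mathcal{H})$, $e^{tA}:=\sum_{n\ge0}\frac{t^n}{n!}A^n$. The semigroup $\{e^{tA}\}_{t\ge0}$ is exponentially stable if there are constants $M\ge1$ and $\omega<0$ with $\|e^{tA}\|\le Me^{\omega t}$ for all $t\ge0$ (for bounded $A$ this is equivalent to $\mathrm{Re}\,\lambda<0$ for all $\lambda$ in the spectrum of $A$). A set $T\subset\mathbb{R}$ is uniformly separated if $\inf\{|t-t'|:t,t'\in T,\,t\ne t'\}>0$. A countable family $\{f_k\}\subset\mathcal{H}$ is a Bessel system if there is $C>0$ with $\sum_k|\langle f,f_k\rangle|^2\le C\|f\|^2$ for all $f\in\mathcal{H}$, and a frame if moreover there is $c>0$ with $c\|f\|^2\le\sum_k|\langle f,f_k\rangle|^2$ for all $f$. For a countable $\mathcal{G}\subset\mathcal{H}$ and an interval $\mathcal{T}\subset[0,\infty)$, $\{e^{tA}g\}_{g\in\mathcal{G},t\in\mathcal{T}}$ is a semi-continuous frame for $\mathcal{H}$ if there are constants $c,C>0$ such that $c\|f\|^2\le\sum_{g\in\mathcal{G}}\int_{\mathcal{T}}|\langle f,e^{tA}g\rangle|^2\,dt\le C\|f\|^2$ for all $f\in\mathcal{H}$. *)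

(* Defs.v *)
From mathcomp Require Import all_boot all_order all_algebra.
From mathcomp Require Import all_classical all_reals all_analysis.
From mathcomp.real_closed Require Import complex.

Set Implicit Arguments.
Unset Strict Implicit.
Unset Printing Implicit Defensive.

Import Order.TTheory GRing.Theory Num.Theory.
Local Open Scope ring_scope.
Local Open Scope classical_set_scope.

Section HilbertDefs.
Variables (R : realType) (H : lmodType R[i]) (ip : H -> H -> R[i]).

Definition abs2 (z : R[i]) : R := complex.Re z ^+ 2 + complex.Im z ^+ 2.

Definition hnorm (x : H) : R := Num.sqrt (complex.Re (ip x x)).

Definition inner_product_axioms : Prop :=
  [/\ (forall (a : R[i]) (x y z : H), ip (a *: x + y) z = a * ip x z + ip y z),
      (forall x y : H, ip y x = conjc (ip x y)),
      (forall x : H, complex.Im (ip x x) = 0 /\ 0 <= complex.Re (ip x x))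
    & (forall x : H, complex.Re (ip x x) = 0 -> x = 0)].

Definition hcauchy (u : nat -> H) : Prop :=
  forall e : R, 0 < e -> exists N : nat, forall m n : nat,
    (N <= m)%N -> (N <= n)%N -> hnorm (u m - u n) < e.

Definition hconverges (u : nat -> H) (l : H) : Prop :=
  forall e : R, 0 < e -> exists N : nat, forall n : nat,
    (N <= n)%N -> hnorm (u n - l) < e.

Definition hcomplete : Prop :=
  forall u : nat -> H, hcauchy u -> exists l : H, hconverges u l.

Definition hseparable : Prop :=
  exists D : set H, countable D /\
    forall (x : H) (e : R), 0 < e -> exists d : H, D d /\ hnorm (x - d) < e.

Definition is_separable_hilbert : Prop :=
  [/\ inner_product_axioms, hcomplete & hseparable].

(* A is a bounded operator (A is linear by its type) *)
Definition bounded_op (A : H -> H) : Prop :=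
  exists K : R, forall x : H, hnorm (A x) <= K * hnorm x.

Definition exp_partial (A : H -> H) (t : R) (f : H) (N : nat) : H :=
  \sum_(n < N) ((t ^+ n / (n`!)%:R)%:C%C *: iter n A f).

Definition expop (A : H -> H) (t : R) (f : H) : H :=
  xget 0 [set l | hconverges (exp_partial A t f) l].

Definition exp_stable (A : H -> H) : Prop :=
  exists M w : R, 1 <= M /\ w < 0 /\
    forall t : R, 0 <= t -> forall f : H,
      hnorm (expop A t f) <= M * expR (w * t) * hnorm f.

Definition bessel_system (G : set H) : Prop :=
  exists C : R, 0 < C /\ forall f : H,
    (\esum_(g in G) (abs2 (ip f g))%:E <= (C * hnorm f ^+ 2)%:E)%E.

Definition uniformly_separated (T : set R) : Prop :=
  exists eps : R, 0 < eps /\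
    forall s s' : R, T s -> T s' -> s <> s' -> eps <= `|s - s'|.

Definition orbit_frame (A : H -> H) (G : set H) (T : set R) : Prop :=
  exists c C : R, 0 < c /\ 0 < C /\ forall f : H,
    ((c * hnorm f ^+ 2)%:E <=
       \esum_(p in [set p : H * R | G p.1 /\ T p.2])
          (abs2 (ip f (expop A p.2 p.1)))%:E)%E /\
    (\esum_(p in [set p : H * R | G p.1 /\ T p.2])
          (abs2 (ip f (expop A p.2 p.1)))%:E <= (C * hnorm f ^+ 2)%:E)%E.

Definition semi_continuous_frame (A : H -> H) (G : set H) : Prop :=
  exists c C : R, 0 < c /\ 0 < C /\ forall f : H,
    ((c * hnorm f ^+ 2)%:E <=
       \esum_(g in G) \int[lebesgue_measure]_(t in `[0%R, +oo[)
          (abs2 (ip f (expop A t g)))%:E)%E /\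
    (\esum_(g in G) \int[lebesgue_measure]_(t in `[0%R, +oo[)
          (abs2 (ip f (expop A t g)))%:E <= (C * hnorm f ^+ 2)%:E)%E.

End HilbertDefs.

(* Main.v *)
Require Import Defs.
From mathcomp Require Import all_boot all_order all_algebra.
From mathcomp Require Import all_classical all_reals all_analysis.
From mathcomp.real_closed Require Import complex.
From mathcomp Require Import finmap measurable_realfun ring lra.

Set Implicit Arguments.
Unset Strict Implicit.
Unset Printing Implicit Defensive.

Import Order.TTheory GRing.Theory Num.Theory.
Import numFieldNormedType.Exports.
Local Open Scope ring_scope.
Local Open Scope classical_set_scope.


(** A bounded generator makes each orbit [e^{tA} g] vary slowly, uniformly in
the Bessel family: expanding [e^{sA} - 1] and applying Cauchy-Schwarz to the
exponential series gives, for [0 <= s <= h], a bound of [|<f, (e^{sA} - 1) u>|^2]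
by a weighted sum of the [|<f, A^n u>|^2] that no longer depends on [s]; summed over
[u = e^{t_j A} g] with the lengths [l_j <= h] as weights, it is [O(h^2) |f|^2], since a
Bessel system stays Bessel under a bounded operator and exponential stability makes
the sum over [j] converge.  Hence the energy [sum_g int |<f, e^{tA} g>|^2 dt] and the
weighted samples [sum_g sum_j l_j |<f, e^{t_j A} g>|^2] control each other up to
a factor 2 and this error, which is absorbed in the lower frame bound when [h] is
small.  For (iii) => (i) only the pieces [jm, jm + h] of the half-line are used,
so that [h] may be taken small although [m] is given. *)

(** * Squared modulus of complex numbers and a weighted Cauchy-Schwarz inequality *)

Section ComplexModulus.
Variable R : realType.
Implicit Types (z w : R[i]) (r : R).

Lemma Re_add z w : complex.Re (z + w) = complex.Re z + complex.Re w.
Proof. by case: z; case: w. Qed.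

Lemma Im_add z w : complex.Im (z + w) = complex.Im z + complex.Im w.
Proof. by case: z; case: w. Qed.

Lemma Re_mulr r z : complex.Re (r%:C%C * z) = r * complex.Re z.
Proof. by case: z => a b /=; rewrite mul0r subr0. Qed.

Lemma Im_mulr r z : complex.Im (r%:C%C * z) = r * complex.Im z.
Proof. by case: z => a b /=; rewrite mul0r addr0. Qed.

Lemma Re_sum (I : Type) (s : seq I) (F : I -> R[i]) :
  complex.Re (\sum_(i <- s) F i) = \sum_(i <- s) complex.Re (F i).
Proof. exact: (big_morph _ Re_add). Qed.

Lemma Im_sum (I : Type) (s : seq I) (F : I -> R[i]) :
  complex.Im (\sum_(i <- s) F i) = \sum_(i <- s) complex.Im (F i).
Proof. exact: (big_morph _ Im_add). Qed.

Lemma abs2_ge0 z : 0 <= abs2 z.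
Proof. by rewrite addr_ge0 // sqr_ge0. Qed.

Lemma abs2M z w : abs2 (z * w) = abs2 z * abs2 w.
Proof. by case: z => a b; case: w => c d; rewrite /abs2 /=; ring. Qed.

Lemma abs2_real r : abs2 r%:C%C = r ^+ 2.
Proof. by rewrite /abs2 /= expr0n addr0. Qed.

Lemma abs2_conjc z : abs2 (conjc z) = abs2 z.
Proof. by case: z => a b; rewrite /abs2 /= sqrrN. Qed.

Lemma abs2N z : abs2 (- z) = abs2 z.
Proof. by case: z => a b; rewrite /abs2 /= !sqrrN. Qed.

Lemma mul_conjc z : conjc z * z = (abs2 z)%:C%C.
Proof.
case: z => a b; rewrite /abs2; simpc; congr (Complex _ _); ring.
Qed.

Lemma abs2D_le z w : abs2 (z + w) <= 2 * abs2 z + 2 * abs2 w.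
Proof.
case: z => a b; case: w => c d; rewrite /abs2 /=.
have := sqr_ge0 (a - c); have := sqr_ge0 (b - d); nra.
Qed.

(** Young's inequality. With [z = a + ib] and [w = c + id], the gap between the two sides is at
    least [k^-1] times the squares of [k a - c] and [k b + d]; the sign change comes from taking
    [z * w] without conjugation. *)
Lemma Re_mul_young (k : R) z w : 0 < k ->
  2 * complex.Re (z * w) <= k * abs2 z + k^-1 * abs2 w.
Proof.
move=> k0; case: z => a b; case: w => c d; rewrite /abs2 /=.
have e0 : k * k^-1 = 1 by rewrite mulfV ?gt_eqF.
have i0 : 0 < k^-1 by rewrite invr_gt0.
have := mulr_ge0 (ltW i0) (sqr_ge0 (k * a - c)).
have := mulr_ge0 (ltW i0) (sqr_ge0 (k * b + d)).
have -> : k^-1 * (k * b + d) ^+ 2 =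
  k * (k * k^-1) * b ^+ 2 + 2 * (k * k^-1) * b * d + k^-1 * d ^+ 2 by ring.
have -> : k^-1 * (k * a - c) ^+ 2 =
  k * (k * k^-1) * a ^+ 2 - 2 * (k * k^-1) * a * c + k^-1 * c ^+ 2 by ring.
rewrite e0; lra.
Qed.

(** Induction on the list: the only term not matched directly is the cross term between the new
    summand and the tail sum [Y]. Young's inequality with parameter [P^-1], where [P] is the total
    weight of the tail, bounds it through the induction hypothesis. *)
Lemma abs2_wsum_le (I : Type) (s : seq I) (p : I -> R) (y : I -> R[i]) :
  (forall i, 0 <= p i) ->
  abs2 (\sum_(i <- s) (p i)%:C%C * y i) <=
    (\sum_(i <- s) p i) * \sum_(i <- s) p i * abs2 (y i).
Proof.
move=> p0; elim: s => [|i s]; first by rewrite !big_nil /abs2 /= expr0n addr0 mul0r.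
rewrite !big_cons; set Y := \sum_(_ <- _) _; set P := \sum_(_ <- _) p _.
set S := \sum_(_ <- _) _ * abs2 _ => IH.
have P0 : 0 <= P by apply: sumr_ge0.
have S0 : 0 <= S by apply: sumr_ge0 => j _; rewrite mulr_ge0 ?abs2_ge0.
have pi0 := p0 i.
suff : p i * (2 * complex.Re (conjc Y * y i)) <= p i * (S + P * abs2 (y i)).
  move: IH; rewrite /abs2 !(Re_add, Im_add, Re_mulr, Im_mulr).
  case: (Y) => a b; case: (y i) => c d /= IH H; nra.
apply: ler_wpM2l => //.
move: P0; rewrite le_eqVlt => /orP[/eqP P0|P0].
  have Y0 : abs2 Y <= 0 by rewrite (le_trans IH) // -P0 mul0r.
  have : abs2 Y = 0 by apply/eqP; rewrite eq_le Y0 abs2_ge0.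
  rewrite /abs2; case: (Y) => a b /= /eqP; rewrite paddr_eq0 ?sqr_ge0 //.
  rewrite !sqrf_eq0 => /andP[/eqP -> /eqP ->].
  by rewrite /= -P0 mul0r; case: (y i) => c d /=; lra.
have Pi : 0 < P^-1 by rewrite invr_gt0.
apply: (le_trans (Re_mul_young _ _ Pi)); rewrite abs2_conjc invrK lerD2r.
by rewrite mulrC ler_pdivrMr // mulrC.
Qed.

End ComplexModulus.

(** * Inner product algebra, Cauchy-Schwarz and the norm *)

Section InnerProduct.
Variables (R : realType) (H : lmodType R[i]) (ip : H -> H -> R[i]).
Hypothesis ipA : inner_product_axioms ip.
Local Notation hnorm := (hnorm ip).
Implicit Types (x y z f : H) (a : R[i]).

Lemma ipDl x y z : ip (x + y) z = ip x z + ip y z.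
Proof. by case: ipA => lin _ _ _; rewrite -[x]scale1r lin scale1r mul1r. Qed.

Lemma ip0l z : ip 0 z = 0.
Proof. by apply: (addrI (ip 0 z)); rewrite -ipDl !addr0. Qed.

Lemma ipZl a x z : ip (a *: x) z = a * ip x z.
Proof. by case: ipA => lin _ _ _; rewrite -[_ *: _]addr0 lin ip0l addr0. Qed.

Lemma ip_conj x y : ip y x = conjc (ip x y).
Proof. by case: ipA => _ + _ _; exact. Qed.

Lemma ipDr x y z : ip x (y + z) = ip x y + ip x z.
Proof. by rewrite ip_conj ipDl rmorphD /= -!ip_conj. Qed.

Lemma ip0r x : ip x 0 = 0.
Proof. by rewrite ip_conj ip0l rmorph0. Qed.

Lemma ipZr a x y : ip x (a *: y) = conjc a * ip x y.
Proof. by rewrite ip_conj ipZl rmorphM /= -ip_conj. Qed.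

Lemma ipZr_real (r : R) x y : ip x (r%:C%C *: y) = r%:C%C * ip x y.
Proof. by rewrite ipZr conjc_real. Qed.

Lemma ipNr x y : ip x (- y) = - ip x y.
Proof. by rewrite -scaleN1r ipZr rmorphN rmorph1 mulN1r. Qed.

Lemma ipBr x y z : ip x (y - z) = ip x y - ip x z.
Proof. by rewrite ipDr ipNr. Qed.

Lemma ip_sumr (I : Type) (s : seq I) (F : I -> H) x :
  ip x (\sum_(i <- s) F i) = \sum_(i <- s) ip x (F i).
Proof. by apply: (big_morph (ip x)) => [y z|]; rewrite ?ipDr ?ip0r. Qed.

Lemma ip_suml (I : Type) (s : seq I) (F : I -> H) x :
  ip (\sum_(i <- s) F i) x = \sum_(i <- s) ip (F i) x.
Proof. by apply: (big_morph (ip^~ x)) => [y z|]; rewrite ?ipDl ?ip0l. Qed.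

Lemma hnorm_ge0 x : 0 <= hnorm x.
Proof. exact: sqrtr_ge0. Qed.

Lemma hnorm_sqr x : hnorm x ^+ 2 = complex.Re (ip x x).
Proof. by case: ipA => _ _ pos _; rewrite sqr_sqrtr //; case: (pos x). Qed.

Lemma ip_self x : ip x x = (hnorm x ^+ 2)%:C%C.
Proof.
rewrite hnorm_sqr; case: ipA => _ _ pos _; case: (pos x).
by case: (ip x x) => a b /= -> _.
Qed.

Lemma hnorm0 : hnorm 0 = 0.
Proof. by rewrite /Defs.hnorm ip0l /= sqrtr0. Qed.

Lemma hnorm0_eq0 x : hnorm x = 0 -> x = 0.
Proof.
move=> x0; case: ipA => _ _ _; apply.
by rewrite -hnorm_sqr x0 expr0n.
Qed.

(** The vector [|y|^2 x - <x, y> y] is a multiple of the component of [x] orthogonal to [y]; its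
    squared norm is [|y|^2] times the difference of the two sides. *)
Lemma abs2_ip_le x y : abs2 (ip x y) <= hnorm x ^+ 2 * hnorm y ^+ 2.
Proof.
have [y0|yn0] := eqVneq (hnorm y) 0.
  by rewrite (hnorm0_eq0 y0) ip0r hnorm0 /abs2 /= expr0n /= addr0 mulr0.
have n0 : 0 < hnorm y ^+ 2 by rewrite exprn_even_gt0.
set n := hnorm y ^+ 2 in n0 *; set z := ip x y.
have := sqr_ge0 (hnorm (n%:C%C *: x - z *: y)).
rewrite [hnorm (_ - _) ^+ 2]hnorm_sqr -scaleNr !ipDl !ipDr !ipZl !ipZr (ip_conj x y) -/z !ip_self -/n.
move: n0; rewrite /abs2; move: (hnorm x ^+ 2) (n) z => m k [a b] k0 /=.
move=> h; have : 0 <= k * (m * k - (a ^+ 2 + b ^+ 2)) by apply: le_trans h _; lra.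
by rewrite pmulr_rge0 // subr_ge0.
Qed.

Lemma Re_ip_le x y : complex.Re (ip x y) <= hnorm x * hnorm y.
Proof.
apply: (@le_trans _ _ `|complex.Re (ip x y)|); first exact: ler_norm.
have h0 : 0 <= hnorm x * hnorm y by rewrite mulr_ge0 ?hnorm_ge0.
rewrite -[leRHS]ger0_norm // -ler_sqr ?nnegrE ?normr_ge0 // !real_normK ?num_real //.
by rewrite exprMn (le_trans _ (abs2_ip_le x y)) // lerDl sqr_ge0.
Qed.

Lemma hnormD x y : hnorm (x + y) <= hnorm x + hnorm y.
Proof.
rewrite -ler_sqr ?nnegrE ?addr_ge0 ?hnorm_ge0 //.
rewrite hnorm_sqr ipDl !ipDr !Re_add -!hnorm_sqr.
have := Re_ip_le x y; have := Re_ip_le y x; lra.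
Qed.

Lemma hnormZ a x : hnorm (a *: x) ^+ 2 = abs2 a * hnorm x ^+ 2.
Proof.
rewrite hnorm_sqr ipZl ipZr mulrA [a * _]mulrC mul_conjc ip_self.
by rewrite Re_mulr.
Qed.

Lemma hnormZ_real (r : R) x : hnorm (r%:C%C *: x) = `|r| * hnorm x.
Proof.
apply/eqP; rewrite -(@eqrXn2 _ 2) ?mulr_ge0 ?hnorm_ge0 //.
by rewrite hnormZ abs2_real exprMn real_normK ?num_real.
Qed.

Lemma hnormN x : hnorm (- x) = hnorm x.
Proof.
apply/eqP; rewrite -(@eqrXn2 _ 2) ?hnorm_ge0 // -scaleN1r hnormZ.
by rewrite abs2N /abs2 /= expr0n expr1n addr0 mul1r.
Qed.

Lemma hnorm_distC x y : hnorm (x - y) = hnorm (y - x).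
Proof. by rewrite -hnormN opprB. Qed.

Lemma hnorm_triangle x y z : hnorm (x - z) <= hnorm (x - y) + hnorm (y - z).
Proof. by rewrite -[x - z](subrKA y) hnormD. Qed.

Lemma hnorm_sum (I : Type) (s : seq I) (P : pred I) (F : I -> H) :
  hnorm (\sum_(i <- s | P i) F i) <= \sum_(i <- s | P i) hnorm (F i).
Proof.
apply: (big_ind2 (fun x (r : R) => hnorm x <= r)) => //; first by rewrite hnorm0.
by move=> x r y q h1 h2; rewrite (le_trans (hnormD _ _)) // lerD.
Qed.

End InnerProduct.

(** * The scalar exponential series and its Cauchy product *)

Section ExponentialSeries.
Variable R : realType.
Implicit Types a b s t : R.

(** Exchange of the sums followed by [n = i + j]. The values lie in a [zmodType] so that the same
    reindexing serves the scalar and the operator exponentials. *)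
Lemma triangular_sum (V : zmodType) (G : nat -> nat -> V) N :
  \sum_(n < N) \sum_(i < n.+1) G i (n - i)%N =
  \sum_(i < N) \sum_(j < N | (i + j < N)%N) G i j.
Proof.
transitivity (\sum_(n < N) \sum_(i < N | (i < n.+1)%N) G i (n - i)%N).
  by apply: eq_bigr => n _; rewrite (big_ord_widen N (fun i => G i (n - i)%N)).
rewrite (exchange_big_dep xpredT) //=; apply: eq_bigr => i _.
have iN := ltnW (ltn_ord i).
transitivity (\sum_(i <= n < N) G i (n - i)%N).
  rewrite -(big_mkord (fun n => (i < n.+1)%N) (fun n => G i (n - i)%N)).
  rewrite (big_cat_nat (n := i)) //= big_nat_cond big1 ?add0r; last first.
    by move=> n /andP[/andP[_ ni]]; rewrite ltnS leqNgt ni.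
  rewrite big_nat_cond [RHS]big_nat_cond; apply: eq_bigl => n.
  by rewrite ltnS; case: (i <= n)%N.
rewrite -{1}[nat_of_ord i]add0n big_addn big_mkord.
rewrite (big_ord_widen_cond N xpredT (fun j => G i (j + i - i)%N)) ?leq_subr //=.
by apply: eq_big => [j|j _]; rewrite ?addnK // ltn_subRL.
Qed.

Definition exp_sum a N : R := \sum_(n < N) (a ^+ n / n`!%:R).

Lemma exp_term_ge0 a n : 0 <= a -> 0 <= a ^+ n / n`!%:R.
Proof. by move=> a0; rewrite mulr_ge0 ?exprn_ge0. Qed.

Lemma exp_sum_cvg a : exp_sum a @ \oo --> expR a.
Proof.
have := @is_cvg_series_exp_coeff R a; rewrite /expR.
by apply: cvg_trans; apply: near_eq_cvg; near=> n; rewrite /series /= big_mkord.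
Unshelve. all: end_near. Qed.

Lemma exp_sum_nd a m n : 0 <= a -> (m <= n)%N -> exp_sum a m <= exp_sum a n.
Proof.
move=> a0 mn; rewrite /exp_sum (big_ord_widen n (fun i => a ^+ i / i`!%:R)) //.
rewrite [leRHS](bigID (fun i : 'I_n => (i < m)%N)) /= lerDl.
by apply: sumr_ge0 => i _; exact: exp_term_ge0.
Qed.

Lemma exp_sum_le a n : 0 <= a -> exp_sum a n <= expR a.
Proof.
move=> a0; have <- := cvg_lim (@Rhausdorff R) (exp_sum_cvg (a := a)).
apply: limr_ge; first by apply/cvg_ex; eexists; exact: exp_sum_cvg.
by near=> m; apply: exp_sum_nd => //; near: m; exact: nbhs_infty_ge.
Unshelve. all: end_near. Qed.

Lemma exp_termD s t n :
  (s + t) ^+ n / n`!%:R =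
  \sum_(i < n.+1) (s ^+ i / i`!%:R) * (t ^+ (n - i) / (n - i)`!%:R).
Proof.
rewrite addrC exprDn mulr_suml; apply: eq_bigr => i _.
have i_n : (i <= n)%N by rewrite -ltnS.
have := bin_fact i_n => /(congr1 (fun k => k%:R : R)); rewrite !natrM => <-.
have h k : k`!%:R != 0 :> R by rewrite pnatr_eq0 -lt0n fact_gt0.
have hb : 'C(n, i)%:R != 0 :> R by rewrite pnatr_eq0 -lt0n bin_gt0.
rewrite -mulr_natr; field.
by rewrite !h hb.
Qed.

(** The terms on or beyond the antidiagonal [i + j = N] are what truncation spoils in the Cauchy
    product. The left side tends to 0, and for nonnegative arguments the right side dominates the
    corresponding operator terms. *)
Lemma exp_sumM_sub a b N :
  exp_sum a N * exp_sum b N - exp_sum (a + b) N =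
  \sum_(i < N) \sum_(j < N | ~~ (i + j < N)%N) (a ^+ i / i`!%:R) * (b ^+ j / j`!%:R).
Proof.
rewrite {3}/exp_sum; under [X in _ - X]eq_bigr do rewrite exp_termD.
rewrite (@triangular_sum _ (fun i j => (a ^+ i / i`!%:R) * (b ^+ j / j`!%:R))).
rewrite /exp_sum mulr_suml -sumrB; apply: eq_bigr => i _.
rewrite mulr_sumr [X in X - _](bigID (fun j : 'I_N => (i + j < N)%N)) /=.
by apply/eqP; rewrite subr_eq addrC.
Qed.

End ExponentialSeries.

(** * Norm convergence and the operator exponential: existence, linearity, semigroup law *)

Section Operators.
Variables (R : realType) (H : lmodType R[i]) (ip : H -> H -> R[i]).
Hypothesis ipA : inner_product_axioms ip.
Local Notation hnorm := (hnorm ip).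
Local Notation "u ~> l" := (hconverges ip u l) (at level 70).
Implicit Types (x y z f l : H) (u v : nat -> H).

Lemma hconvergesP u l : u ~> l <-> (fun n => hnorm (u n - l)) @ \oo --> (0 : R).
Proof.
split=> [ul|/cvgrPdist_lt ul e e0].
  apply/cvgrPdist_lt => e /ul[N uN]; exists N => // n /= Nn.
  by rewrite sub0r normrN ger0_norm ?hnorm_ge0 // uN.
have [N _ uN] := ul e e0; exists N => n Nn.
by have := uN n Nn; rewrite /= sub0r normrN ger0_norm ?hnorm_ge0.
Qed.

Lemma hconverges_bound u l (b : R^nat) :
  (forall n, hnorm (u n - l) <= b n) -> b @ \oo --> (0 : R) -> u ~> l.
Proof.
move=> ub b0; apply/hconvergesP; apply: (squeeze_cvgr _ (cvg_cst 0) b0).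
by apply: nearW => n; rewrite hnorm_ge0 ub.
Qed.

Lemma hconverges_unique u l1 l2 : u ~> l1 -> u ~> l2 -> l1 = l2.
Proof.
move=> /hconvergesP u1 /hconvergesP u2; apply/eqP; rewrite -subr_eq0; apply/eqP.
apply: (hnorm0_eq0 ipA); apply/eqP; rewrite eq_le hnorm_ge0 andbT.
have c : (fun n => hnorm (u n - l1) + hnorm (u n - l2)) @ \oo --> (0 : R).
  by rewrite -[0]addr0; exact: cvgD.
apply: (ler_cvg_to (cvg_cst (hnorm (l1 - l2))) c); apply: nearW => n /=.
by rewrite (hnorm_distC ipA (u n) l1) (hnorm_triangle ipA).
Qed.

Lemma hconvergesD u v l m : u ~> l -> v ~> m -> (fun n => u n + v n) ~> l + m.
Proof.
move=> /hconvergesP ul /hconvergesP vm.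
apply: hconverges_bound; last by rewrite -[0]addr0; exact: cvgD ul vm.
by move=> n; rewrite opprD addrACA (hnormD ipA).
Qed.

Lemma hconvergesZ (a : R[i]) u l : u ~> l -> (fun n => a *: u n) ~> a *: l.
Proof.
move=> /hconvergesP ul.
apply: (@hconverges_bound _ _ (fun n => Num.sqrt (abs2 a) * hnorm (u n - l))).
  move=> n; rewrite -scalerBr -ler_sqr ?nnegrE ?mulr_ge0 ?hnorm_ge0 ?sqrtr_ge0 //.
  by rewrite (hnormZ ipA) exprMn (sqr_sqrtr (abs2_ge0 a)).
by rewrite -(mulr0 (Num.sqrt (abs2 a))); apply: cvgM => //; exact: cvg_cst.
Qed.

Lemma cvg_abs2_ip u l f : u ~> l -> (fun n => abs2 (ip f (u n - l))) @ \oo --> (0 : R).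
Proof.
move=> /hconvergesP ul.
have ul2 : (fun n => hnorm f ^+ 2 * (hnorm (u n - l) * hnorm (u n - l))) @ \oo --> (0 : R).
  rewrite -(mulr0 (hnorm f ^+ 2)); apply: cvgM; first exact: cvg_cst.
  by rewrite -(mulr0 0); exact: cvgM.
apply: (squeeze_cvgr _ (cvg_cst 0) ul2); apply: nearW => n.
by rewrite abs2_ge0 (abs2_ip_le ipA).
Qed.

Lemma cvg_Re_ip u l f : u ~> l ->
  (fun n => complex.Re (ip f (u n))) @ \oo --> complex.Re (ip f l).
Proof.
move=> ul; apply/cvgrPdist_lt => e e0.
have /cvgrPdist_lt/(_ (e ^+ 2)) := cvg_abs2_ip f ul.
move=> /(_ ltac:(by rewrite exprn_gt0)); apply: filterS => n.
rewrite sub0r normrN ger0_norm ?abs2_ge0 // ipBr // => h.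
rewrite -ltr_sqr ?nnegrE ?normr_ge0 ?(ltW e0) // real_normK ?num_real //.
apply: le_lt_trans h; rewrite /abs2.
case: (ip f l) => a b; case: (ip f (u n)) => c d /=.
have := sqr_ge0 (d - b); lra.
Qed.

Lemma cvg_Im_ip u l f : u ~> l ->
  (fun n => complex.Im (ip f (u n))) @ \oo --> complex.Im (ip f l).
Proof.
move=> ul; apply/cvgrPdist_lt => e e0.
have /cvgrPdist_lt/(_ (e ^+ 2)) := cvg_abs2_ip f ul.
move=> /(_ ltac:(by rewrite exprn_gt0)); apply: filterS => n.
rewrite sub0r normrN ger0_norm ?abs2_ge0 // ipBr // => h.
rewrite -ltr_sqr ?nnegrE ?normr_ge0 ?(ltW e0) // real_normK ?num_real //.
apply: le_lt_trans h; rewrite /abs2.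
case: (ip f l) => a b; case: (ip f (u n)) => c d /=.
have := sqr_ge0 (c - a); lra.
Qed.

Lemma cvg_abs2_ip_lim u l f : u ~> l ->
  (fun n => abs2 (ip f (u n))) @ \oo --> abs2 (ip f l).
Proof.
move=> ul; rewrite /abs2 !expr2; apply: cvgD; apply: cvgM.
- exact: cvg_Re_ip.
- exact: cvg_Re_ip.
- exact: cvg_Im_ip.
- exact: cvg_Im_ip.
Qed.

Hypothesis Hcomplete : hcomplete ip.

Lemma hcauchy_bound u (b : R^nat) :
  (forall m n, (n <= m)%N -> hnorm (u m - u n) <= b n) -> b @ \oo --> (0 : R) ->
  exists l, u ~> l.
Proof.
move=> ub b0; apply: Hcomplete => e e0.
have /cvgrPdist_lt/(_ e e0)[N _ bN] := b0.
have {}bN n : (N <= n)%N -> b n < e.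
  move=> /bN /=; rewrite sub0r normrN; apply: le_lt_trans; exact: ler_norm.
exists N => m n Nm Nn; have [nm|/ltnW mn] := leqP n m.
  exact: le_lt_trans (ub _ _ nm) (bN _ Nn).
rewrite (hnorm_distC ipA); exact: le_lt_trans (ub _ _ mn) (bN _ Nm).
Qed.

Variables (A : {linear H -> H}) (K : R).
Hypothesis K0 : 0 <= K.
Hypothesis AK : forall x, hnorm (A x) <= K * hnorm x.

Lemma iter_linearD n x y : iter n A (x + y) = iter n A x + iter n A y.
Proof. by elim: n => //= n ->; rewrite linearD. Qed.

Lemma iter_linearZ n (a : R[i]) x : iter n A (a *: x) = a *: iter n A x.
Proof. by elim: n => //= n ->; rewrite linearZ. Qed.

Lemma iter_linear_sum n (I : Type) (s : seq I) (F : I -> H) :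
  iter n A (\sum_(i <- s) F i) = \sum_(i <- s) iter n A (F i).
Proof.
apply: (big_morph (iter n A)) => [x y|]; first exact: iter_linearD.
by elim: n => //= n ->; rewrite linear0.
Qed.

Lemma hnorm_iter_le n x : hnorm (iter n A x) <= K ^+ n * hnorm x.
Proof.
elim: n => [|n IH] /=; first by rewrite expr0 mul1r.
by rewrite (le_trans (AK _)) // exprS -mulrA ler_wpM2l.
Qed.

Lemma hnorm_exp_term_le t n x :
  hnorm ((t ^+ n / (n`!)%:R)%:C%C *: iter n A x) <=
    (`|t| * K) ^+ n / n`!%:R * hnorm x.
Proof.
rewrite (hnormZ_real ipA) normrM normrX normfV (ger0_norm (ler0n _ _)) exprMn.
rewrite -mulrA -[leRHS]mulrA -mulrA; apply: ler_wpM2l; first exact: exprn_ge0.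
by rewrite mulrCA; apply: ler_wpM2l; rewrite ?invr_ge0 // hnorm_iter_le.
Qed.

Local Notation P := (exp_partial A).
Local Notation E := (expop ip A).

Lemma hnorm_exp_partial_sub_le t x m n : (n <= m)%N ->
  hnorm (P t x m - P t x n) <=
    (exp_sum (`|t| * K) m - exp_sum (`|t| * K) n) * hnorm x.
Proof.
move=> nm; have PE k : P t x k = \sum_(0 <= i < k) ((t ^+ i / (i`!)%:R)%:C%C *: iter i A x).
  by rewrite big_mkord.
have eE k : exp_sum (`|t| * K) k = \sum_(0 <= i < k) ((`|t| * K) ^+ i / i`!%:R).
  by rewrite big_mkord.
rewrite !PE !eE !(@big_cat_nat _ _ _ n 0 m) //= addrAC subrr add0r.
rewrite [X in X * _]addrAC subrr add0r mulr_suml.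
apply: (le_trans (hnorm_sum ipA _ _ _)).
by apply: ler_sum => i _; exact: hnorm_exp_term_le.
Qed.

Let c0 (t : R) : 0 <= `|t| * K. Proof. by rewrite mulr_ge0. Qed.

Lemma exp_partial_cvg t x : P t x ~> E t x.
Proof.
have [l Pl] : exists l, P t x ~> l.
  apply: (@hcauchy_bound _
    (fun n => (expR (`|t| * K) - exp_sum (`|t| * K) n) * hnorm x)).
    move=> m n nm; apply: (le_trans (hnorm_exp_partial_sub_le _ _ nm)).
    by rewrite ler_wpM2r ?hnorm_ge0 // lerD2r exp_sum_le.
  rewrite -(mul0r (hnorm x)); apply: cvgM; last exact: cvg_cst.
  rewrite -(subrr (expR (`|t| * K))); apply: cvgB; first exact: cvg_cst.
  exact: exp_sum_cvg.
(* [expop] picks a limit with default value 0; as a limit exists, the default is never taken. *)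
rewrite /expop; case: xgetP => [y _ //|/(_ l)]; first by [].
Qed.

Lemma hnorm_exp_partial_le t x n : hnorm (P t x n) <= expR (`|t| * K) * hnorm x.
Proof.
apply: (le_trans (hnorm_sum ipA _ _ _)).
apply: (@le_trans _ _ (exp_sum (`|t| * K) n * hnorm x)); last first.
  by rewrite ler_wpM2r ?hnorm_ge0 // exp_sum_le.
by rewrite /exp_sum mulr_suml; apply: ler_sum => i _; exact: hnorm_exp_term_le.
Qed.

Lemma exp_partialD t x y n : P t (x + y) n = P t x n + P t y n.
Proof.
rewrite /exp_partial -big_split /=; apply: eq_bigr => i _.
by rewrite iter_linearD scalerDr.
Qed.

Lemma exp_partialZ t a x n : P t (a *: x) n = a *: P t x n.
Proof.
rewrite /exp_partial scaler_sumr; apply: eq_bigr => i _.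
by rewrite iter_linearZ !scalerA mulrC.
Qed.

Lemma expopD t x y : E t (x + y) = E t x + E t y.
Proof.
apply: hconverges_unique (exp_partial_cvg _ _) _.
rewrite (_ : P t (x + y) = fun n => P t x n + P t y n); last first.
  by apply/funext => n; rewrite exp_partialD.
by apply: hconvergesD; exact: exp_partial_cvg.
Qed.

Lemma expopZ t a x : E t (a *: x) = a *: E t x.
Proof.
apply: hconverges_unique (exp_partial_cvg _ _) _.
rewrite (_ : P t (a *: x) = fun n => a *: P t x n); last first.
  by apply/funext => n; rewrite exp_partialZ.
by apply: hconvergesZ; exact: exp_partial_cvg.
Qed.

(** The operator form of [exp_sumM_sub], with the same index set, so that the two can be compared
    term by term. *)
Lemma exp_partialM_sub s t x N :
  P s (P t x N) N - P (s + t) x N =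
  \sum_(i < N) \sum_(j < N | ~~ (i + j < N)%N)
    ((s ^+ i / i`!%:R) * (t ^+ j / j`!%:R))%:C%C *: iter (i + j) A x.
Proof.
pose G i j := ((s ^+ i / i`!%:R) * (t ^+ j / j`!%:R))%:C%C *: iter (i + j) A x.
have -> : P (s + t) x N = \sum_(i < N) \sum_(j < N | (i + j < N)%N) G i j.
  rewrite -(triangular_sum G); apply: eq_bigr => n _.
  rewrite exp_termD rmorph_sum scaler_suml; apply: eq_bigr => i _.
  by rewrite /G subnKC // -ltnS.
rewrite /exp_partial -sumrB; apply: eq_bigr => i _.
rewrite iter_linear_sum scaler_sumr.
under eq_bigr do rewrite iter_linearZ scalerA -iterD -rmorphM.
apply/eqP; rewrite subr_eq addrC.
by rewrite [X in X == _](bigID (fun j : 'I_N => (i + j < N)%N)).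
Qed.

(** The partial sums at [s + t] are shown to converge to [E s (E t x)] as well. The error splits
    into three null sequences: the truncation defect, dominated by the scalar one, which vanishes by
    [expRD]; the replacement of [P t x N] by its limit, where the outer partial sums are bounded
    uniformly by [expR a]; and the convergence of the outer series at the fixed vector [E t x]. *)
Lemma expop_semigroup s t x : E (s + t) x = E s (E t x).
Proof.
apply: hconverges_unique (exp_partial_cvg _ _) _.
pose a := `|s| * K; pose b := `|t| * K.
apply: (@hconverges_bound _ _ (fun N =>
   (exp_sum a N * exp_sum b N - exp_sum (a + b) N) * hnorm x
   + (expR a * hnorm (P t x N - E t x) + hnorm (P s (E t x) N - E s (E t x))))).
  move=> N; rewrite (le_trans (hnorm_triangle ipA _ (P s (P t x N) N) _)) // lerD //.
    rewrite (hnorm_distC ipA) exp_partialM_sub exp_sumM_sub.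
    rewrite mulr_suml (le_trans (hnorm_sum ipA _ _ _)) //; apply: ler_sum => i _.
    rewrite mulr_suml (le_trans (hnorm_sum ipA _ _ _)) //; apply: ler_sum => j _.
    rewrite (hnormZ_real ipA) !normrM !normrX !normfV !(ger0_norm (ler0n _ _)).
    rewrite /a /b !exprMn.
    have -> : `|s| ^+ i * K ^+ i / i`!%:R * (`|t| ^+ j * K ^+ j / j`!%:R) * hnorm x
      = `|s| ^+ i / i`!%:R * (`|t| ^+ j / j`!%:R) * (K ^+ (i + j) * hnorm x).
      by rewrite exprD; ring.
    by apply: ler_wpM2l; rewrite ?hnorm_iter_le // !mulr_ge0 ?exprn_ge0.
  rewrite (le_trans (hnorm_triangle ipA _ (P s (E t x) N) _)) // lerD2r.
  have -> : P s (P t x N) N - P s (E t x) N = P s (P t x N - E t x) N.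
    by rewrite -scaleN1r -exp_partialZ -exp_partialD scaleN1r.
  exact: hnorm_exp_partial_le.
rewrite -[0]addr0; apply: cvgD.
  rewrite -(mul0r (hnorm x)); apply: cvgM; last exact: cvg_cst.
  rewrite -(subrr (expR (a + b))) {1}expRD; apply: cvgB; last exact: exp_sum_cvg.
  by apply: cvgM; exact: exp_sum_cvg.
rewrite -[0]addr0; apply: cvgD; last by apply/hconvergesP; exact: exp_partial_cvg.
rewrite -(mulr0 (expR a)); apply: cvgM; first exact: cvg_cst.
by apply/hconvergesP; exact: exp_partial_cvg.
Qed.

End Operators.

(** * Unconditional sums of extended reals *)

Section UnconditionalSums.
Variable R : realType.
Local Open Scope ereal_scope.

Lemma esum_le_finite (T : choiceType) (I : set T) (a : T -> \bar R) x :
  (forall s : {fset T}, (forall i, i \in s -> I i) -> \sum_(i <- s) a i <= x) ->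
  \esum_(i in I) a i <= x.
Proof.
move=> ax; apply: ge_ereal_sup => _ [X [finX XI] <-].
rewrite fsbig_finite //=; apply: ax => i; by rewrite in_fset_set // => /set_mem /XI.
Qed.

Lemma sum_le_esum (T : choiceType) (I : set T) (a : T -> \bar R) (s : {fset T}) :
  (forall i, i \in s -> I i) -> \sum_(i <- s) a i <= \esum_(i in I) a i.
Proof.
move=> sI; apply: ereal_sup_ubound; exists [set` s].
  by split => //; exact: finite_fset.
by rewrite fsbig_finite //= set_fsetK.
Qed.

Lemma le_esum_nat (a : nat -> \bar R) x : (forall n, 0 <= a n) ->
  (forall N, \sum_(n < N) a n <= x) -> \esum_(n in [set: nat]) a n <= x.
Proof.
move=> a0 ax; rewrite -nneseries_esumT //; apply: lime_le.
  exact: is_cvg_nneseries.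
by apply: nearW => N; rewrite big_mkord.
Qed.

Lemma sum_le_esum_nat (a : nat -> \bar R) N : (forall n, 0 <= a n) ->
  \sum_(n < N) a n <= \esum_(n in [set: nat]) a n.
Proof.
move=> a0; rewrite -nneseries_esumT // -(big_mkord xpredT).
exact: nneseries_lim_ge.
Qed.

(** Finite subsums give one inequality for every positive factor; the reverse one is that inequality
    for the factor [c^-1]. *)
Lemma esumZl (T : choiceType) (I : set T) (a : T -> \bar R) (c : R) : (0 < c)%R ->
  (forall i, I i -> 0 <= a i) ->
  \esum_(i in I) (c%:E * a i) = c%:E * \esum_(i in I) a i.
Proof.
have le (k : R) (b : T -> \bar R) : (0 < k)%R -> (forall i, I i -> 0 <= b i) ->
    \esum_(i in I) (k%:E * b i) <= k%:E * \esum_(i in I) b i.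
  move=> k0 b0; apply: esum_le_finite => s sI.
  rewrite big_seq -ge0_sume_distrr; last by move=> i /sI; exact: b0.
  rewrite -big_seq; apply: lee_wpmul2l; first by rewrite lee_fin ltW.
  exact: sum_le_esum.
move=> c0 a0; apply/eqP; rewrite eq_le le //=.
have ci0 : (0 < c^-1)%R by rewrite invr_gt0.
rewrite [X in _ * X](_ : _ = \esum_(i in I) (c^-1%:E * (c%:E * a i))); last first.
  by apply: eq_esum => i _; rewrite muleA -EFinM mulVf ?gt_eqF // mul1e.
have ca0 i : I i -> 0 <= c%:E * a i by move=> Ii; rewrite mule_ge0 ?a0 // lee_fin ltW.
apply: le_trans (lee_wpmul2l _ (le _ _ ci0 ca0)) _; first by rewrite lee_fin ltW.
by rewrite muleA -EFinM mulfV ?gt_eqF // mul1e.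
Qed.

Lemma exchange_esum (T T' : choiceType) (I : set T) (J : set T') (a : T -> T' -> \bar R) :
  (forall i j, 0 <= a i j) ->
  \esum_(i in I) \esum_(j in J) a i j = \esum_(j in J) \esum_(i in I) a i j.
Proof.
move=> a0; rewrite (@esum_esum _ _ _ I (fun=> J)) // (@esum_esum _ _ _ J (fun=> I)) //.
rewrite (reindex_esum (J `*`` (fun=> I)) _ (fun p => (p.2, p.1))) //.
split=> [[j i] [/= ? ?] //|[j i] [j' i'] _ _ [-> ->] //|[i j] [/= Ii Jj]].
by exists (j, i).
Qed.

End UnconditionalSums.

(** * Bessel systems under a bounded operator *)

Section Bessel.
Variables (R : realType) (H : lmodType R[i]) (ip : H -> H -> R[i]).
Hypothesis ipA : inner_product_axioms ip.
Local Notation hnorm := (hnorm ip).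
Variables (G : set H) (C : R).
Hypothesis C0 : 0 < C.
Hypothesis GC : forall f : H,
  (\esum_(g in G) (abs2 (ip f g))%:E <= (C * hnorm f ^+ 2)%:E)%E.

(* With [c g = <f, L g>] and [x] the combination of the [g]'s with coefficients
   [c g], the sum [S] of the [|c g|^2] equals [<f, L x>], while the Bessel bound
   at [x] gives [|x|^2 <= C S].  No adjoint of [L] is involved. *)
Lemma bessel_image (L : H -> H) (k : R) (f : H) :
  {morph L : x y / x + y} -> (forall a, {morph L : x / a *: x}) ->
  0 <= k -> (forall x, hnorm (L x) <= k * hnorm x) ->
  (\esum_(g in G) (abs2 (ip f (L g)))%:E <= (C * k ^+ 2 * hnorm f ^+ 2)%:E)%E.
Proof.
move=> LD LZ k0 Lk; apply: esum_le_finite => s sG.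
rewrite sumEFin lee_fin; set S := \sum_(_ <- _) _.
pose x := \sum_(g <- s) ip f (L g) *: g.
have L0 : L 0 = 0 by have := LZ 0 0; rewrite !scale0r.
have S0 : 0 <= S by apply: sumr_ge0 => g _; exact: abs2_ge0.
have SE : S = complex.Re (ip f (L x)).
  rewrite (big_morph L LD L0) (ip_sumr ipA) Re_sum; apply: eq_bigr => g _.
  by rewrite LZ (ipZr ipA) mul_conjc.
have SL : S <= k * hnorm f * hnorm x.
  rewrite SE (le_trans (Re_ip_le ipA _ _)) // -mulrA mulrCA.
  by rewrite ler_wpM2l ?hnorm_ge0.
have sx : \sum_(g <- s) abs2 (ip x g) <= C * hnorm x ^+ 2.
  rewrite -lee_fin -sumEFin; apply: le_trans (GC x).
  exact: sum_le_esum.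
(* Young's inequality with parameter [C] bounds [2 |x|^2] by [C S] plus [C^-1] times the Bessel sum
   at [x]; the latter is at most [|x|^2] and is absorbed on the left. *)
have xS : hnorm x ^+ 2 <= C * S.
  suff : 2 * hnorm x ^+ 2 <= C * S + C^-1 * (C * hnorm x ^+ 2).
    by rewrite mulKf ?gt_eqF //; lra.
  rewrite (le_trans _ (lerD (lexx _) (ler_wpM2l _ sx))) ?invr_ge0 ?(ltW C0) //.
  rewrite (hnorm_sqr ipA) {1}/x (ip_suml ipA) Re_sum !mulr_sumr -big_split /=.
  apply: ler_sum => g _; rewrite (ipZl ipA) (ip_conj ipA x g) -(abs2_conjc (ip x g)).
  exact: Re_mul_young.
move: S0; rewrite le_eqVlt => /orP[/eqP <-|S0].
  apply: mulr_ge0; [apply: mulr_ge0|]; rewrite ?sqr_ge0 //; exact: ltW.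
(* The claim times [S] follows from [S^2 <= k^2 |f|^2 |x|^2 <= k^2 |f|^2 C S]. *)
rewrite -(ler_pM2r S0) -expr2.
have h0 : 0 <= k * hnorm f * hnorm x by rewrite !mulr_ge0 ?hnorm_ge0.
apply: (@le_trans _ _ ((k * hnorm f * hnorm x) ^+ 2)).
  by rewrite ler_sqr ?nnegrE ?(ltW S0).
rewrite exprMn; apply: (le_trans (ler_wpM2l (sqr_ge0 _) xS)).
by rewrite exprMn le_eqVlt; apply/orP; left; apply/eqP; ring.
Qed.

End Bessel.

(** * Small-time deviation of the semigroup from the identity *)

Section Sampling.
Variables (R : realType) (H : lmodType R[i]) (ip : H -> H -> R[i]).
Hypothesis ipA : inner_product_axioms ip.
Hypothesis Hcomplete : hcomplete ip.
Local Notation hnorm := (hnorm ip).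
Variables (A : {linear H -> H}) (K : R).
Hypothesis K0 : 0 < K.
Hypothesis AK : forall x, hnorm (A x) <= K * hnorm x.
Local Notation E := (expop ip A).

(* A bound, uniform in [0 <= s <= h], for [|<f, e^{sA} u - u>|^2]: it is what
   Cauchy-Schwarz gives for the exponential series with weights [(h K)^n / n!]. *)
Definition exp_err (f : H) (h : R) (u : H) : \bar R :=
  \esum_(n in [set: nat])
    ((expR (h * K) - 1) * (h ^+ n.+1 / n.+1`!%:R / K ^+ n.+1)
      * abs2 (ip f (iter n.+1 A u)))%:E.

Lemma exp_err_term_ge0 f h u n : 0 <= h ->
  0 <= (expR (h * K) - 1) * (h ^+ n.+1 / n.+1`!%:R / K ^+ n.+1)
      * abs2 (ip f (iter n.+1 A u)).
Proof.
move=> h0; have hK0 : 0 <= h * K by rewrite mulr_ge0 // ltW.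
apply: mulr_ge0 (abs2_ge0 _); apply: mulr_ge0.
  by rewrite subr_ge0 -[leLHS]expR0 ler_expR.
by rewrite divr_ge0 ?exp_term_ge0 ?exprn_ge0 // ltW.
Qed.

Lemma exp_err_ge0 f h u : 0 <= h -> (0 <= exp_err f h u)%E.
Proof. by move=> h0; apply: esum_ge0 => n _; rewrite lee_fin exp_err_term_ge0. Qed.

Lemma exp_sumS1 (a : R) N :
  exp_sum a N.+1 = 1 + \sum_(n < N) (a ^+ n.+1 / n.+1`!%:R).
Proof. by rewrite /exp_sum big_ord_recl /= expr0 divr1. Qed.

(** The constant term of the series cancels [u], hence the shifted indices. Weighted Cauchy-Schwarz
    is applied with weights [p n], the terms of the exponential series at [s K], against the values
    [y n] divided by powers of [K]; afterwards [s] is replaced by [h] in each factor. *)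
Lemma exp_partial_err f h s u N : 0 <= s -> s <= h ->
  ((abs2 (ip f (exp_partial A s u N.+1 - u)))%:E <= exp_err f h u)%E.
Proof.
move=> s0 sh; have h0 := le_trans s0 sh; have K0' := ltW K0.
have -> : exp_partial A s u N.+1 - u =
    \sum_(n < N) ((s ^+ n.+1 / n.+1`!%:R)%:C%C *: iter n.+1 A u).
  by rewrite /exp_partial big_ord_recl /= expr0 divr1 scale1r addrC addKr.
pose p n := s ^+ n.+1 / n.+1`!%:R * K ^+ n.+1.
pose y n := (K ^+ n.+1)^-1%:C%C * ip f (iter n.+1 A u).
have -> : ip f (\sum_(n < N) ((s ^+ n.+1 / n.+1`!%:R)%:C%C *: iter n.+1 A u)) =
    \sum_(n < N) (p n)%:C%C * y n.
  rewrite (ip_sumr ipA); apply: eq_bigr => n _.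
  by rewrite (ipZr_real ipA) mulrA -rmorphM /p mulfK // expf_neq0 ?gt_eqF.
have p0 n : 0 <= p n by rewrite mulr_ge0 ?exp_term_ge0 ?exprn_ge0.
have wy0 n : 0 <= p n * abs2 (y n) by rewrite mulr_ge0 ?abs2_ge0.
apply: (@le_trans _ _ (\sum_(n < N) ((expR (h * K) - 1) * (h ^+ n.+1 / n.+1`!%:R / K ^+ n.+1)
      * abs2 (ip f (iter n.+1 A u)))%:E)%E); last first.
  apply: (sum_le_esum_nat (a := fun n => ((expR (h * K) - 1) *
    (h ^+ n.+1 / n.+1`!%:R / K ^+ n.+1) * abs2 (ip f (iter n.+1 A u)))%:E)).
  by move=> n; rewrite lee_fin exp_err_term_ge0.
rewrite sumEFin lee_fin.
apply: (le_trans (abs2_wsum_le _ _ (fun n : 'I_N => p0 n))).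
under [leRHS]eq_bigr do rewrite -mulrA; rewrite -mulr_sumr.
apply: ler_pM; [exact: sumr_ge0 | exact: sumr_ge0 | |].
  have -> : \sum_(n < N) p n = exp_sum (s * K) N.+1 - 1.
    rewrite exp_sumS1 addrC addKr; apply: eq_bigr => n _.
    by rewrite /p exprMn mulrAC.
  rewrite lerD2r (le_trans (exp_sum_le _ _)) ?mulr_ge0 // ler_expR.
  by rewrite ler_wpM2r.
apply: ler_sum => n _; rewrite /y abs2M abs2_real mulrA.
apply: ler_wpM2r; first exact: abs2_ge0.
have Kn : K ^+ n.+1 != 0 by rewrite expf_neq0 ?gt_eqF.
have -> : p n * (K ^+ n.+1)^-1 ^+ 2 = s ^+ n.+1 / n.+1`!%:R / K ^+ n.+1.
  by rewrite /p expr2 mulrA mulfK.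
apply: ler_wpM2r; first by rewrite invr_ge0 exprn_ge0.
apply: ler_wpM2r; first by rewrite invr_ge0.
by rewrite lerXn2r ?nnegrE.
Qed.

Lemma expop_err f h s u : 0 <= s -> s <= h ->
  ((abs2 (ip f (E s u - u)))%:E <= exp_err f h u)%E.
Proof.
move=> s0 sh; have h0 := le_trans s0 sh.
have := fun N => @exp_partial_err f h s u N s0 sh.
have := exp_err_ge0 f u h0.
case: (exp_err f h u) => [e _ He|_ _|]; [|exact: leey|by []].
have c := exp_partial_cvg ipA Hcomplete (ltW K0) AK s u.
have : hconverges ip (fun N => exp_partial A s u N - u) (E s u - u).
  move=> e0 e00; have [N HN] := c _ e00; exists N => n /HN.
  by rewrite opprB addrA subrK.
move=> /(@cvg_abs2_ip_lim _ _ _ ipA _ _ f) c2; rewrite lee_fin; apply: (cvgr_to_le c2).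
(* The bound concerns partial sums with at least one term, so it holds from index 1 on. *)
exists 1%N => // -[//|N] _ /=.
by rewrite -lee_fin; exact: He.
Qed.

Variables (G : set H) (f : H) (W : R).
(** Summing over [G] first, the factor [(K ^+ n.+1) ^+ 2] of the Bessel bound meets the [K ^+ n.+1]
    in the denominator of the weight. What remains is the exponential series at [h K] without its
    constant term, which produces the second factor [expR (h * K) - 1]. *)
Lemma esum_exp_err (v : H -> H) h : 0 < h ->
  (forall n, (\esum_(g in G) (abs2 (ip f (iter n A (v g))))%:E
     <= (W * (K ^+ n) ^+ 2)%:E)%E) ->
  (\esum_(g in G) exp_err f h (v g) <= ((expR (h * K) - 1) ^+ 2 * W)%:E)%E.
Proof.
move=> h0 vW; have hK0 : 0 < h * K by rewrite mulr_gt0.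
have e0 : 0 < expR (h * K) - 1 by rewrite subr_gt0 -[ltLHS]expR0 ltr_expR.
have W0 : 0 <= W.
  rewrite -lee_fin; have := vW 0%N; rewrite expr0 expr1n mulr1; apply: le_trans.
  by apply: esum_ge0 => g _; rewrite lee_fin abs2_ge0.
have w0 n : 0 < (expR (h * K) - 1) * (h ^+ n.+1 / n.+1`!%:R / K ^+ n.+1).
  by rewrite mulr_gt0 // divr_gt0 ?exprn_gt0 // divr_gt0 ?exprn_gt0 // ltr0n fact_gt0.
rewrite /exp_err exchange_esum; last first.
  by move=> g n; rewrite lee_fin exp_err_term_ge0 // ltW.
apply: le_esum_nat => [n|N].
  by apply: esum_ge0 => g _; rewrite lee_fin exp_err_term_ge0 // ltW.
apply: (@le_trans _ _ (\sum_(n < N) ((expR (h * K) - 1) * W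
    * ((h * K) ^+ n.+1 / n.+1`!%:R))%:E)%E); last first.
  rewrite sumEFin lee_fin -mulr_sumr.
  rewrite expr2 mulrAC; apply: ler_wpM2r => //; apply: ler_wpM2l; first exact: ltW.
  rewrite lerBrDl -exp_sumS1; exact: exp_sum_le (ltW _).
apply: lee_sum => n _.
under eq_esum do rewrite EFinM.
rewrite esumZl //; last by move=> g _; rewrite lee_fin abs2_ge0.
apply: le_trans (lee_wpmul2l _ (vW n.+1)) _; first by rewrite lee_fin ltW.
rewrite -EFinM lee_fin le_eqVlt; apply/orP; left; apply/eqP.
have Kn : K ^+ n.+1 != 0 by rewrite expf_neq0 ?gt_eqF.
rewrite exprMn expr2 mulrACA; congr *%R.
have hf : n.+1`!%:R != 0 :> R by rewrite pnatr_eq0 -lt0n fact_gt0.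
rewrite !mulrA; field.
by rewrite hf Kn.
Qed.

End Sampling.

(** * Comparison of an integral over the half-line with samples on disjoint cells *)

Section IntegralSampling.
Variable R : realType.
Local Notation mu := (@lebesgue_measure R).
Variable F : R -> R.
Hypothesis F0 : forall x, 0 <= F x.
Hypothesis mF : measurable_fun [set: R] F.
Local Open Scope ereal_scope.

Let mFE (D : set R) : measurable_fun D (EFin \o F).
Proof. by apply/measurable_EFinP; exact: measurable_funTS. Qed.

Let mu_itv (a l : R) : (0 < l)%R -> mu `[a, (a + l)%R[%classic = l%:E.
Proof.
by move=> l0; rewrite lebesgue_measure_itv /= lte_fin ltrDl l0 -EFinB addrC addKr.
Qed.

Lemma integral_itv_le (a l : R) (c : \bar R) : (0 < l)%R -> 0 <= c ->
  (forall x, (a <= x)%R -> (x < a + l)%R -> (F x)%:E <= c) ->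
  \int[mu]_(x in `[a, (a + l)%R[%classic) (F x)%:E <= c * l%:E.
Proof.
move=> l0 c0 Fc; rewrite -(mu_itv a l0) -integral_cst //.
apply: ge0_le_integral => //.
- by move=> x _; rewrite lee_fin.
- exact: mFE.
- by move=> x; rewrite /= in_itv /= => /andP[]; exact: Fc.
Qed.

Lemma itv_le_integral (a l r : R) (c : \bar R) : (0 < l)%R -> (0 <= r)%R -> 0 <= c ->
  (forall x, (a <= x)%R -> (x < a + l)%R -> r%:E <= 2%:E * (F x)%:E + c) ->
  (l * r)%:E <= 2%:E * \int[mu]_(x in `[a, (a + l)%R[%classic) (F x)%:E + c * l%:E.
Proof.
move=> l0 r0 c0 Fc.
rewrite mulrC EFinM -(mu_itv a l0) -!integral_cst //.
rewrite -ge0_integralZl //; last 2 first.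
- exact: mFE.
- by move=> x _; rewrite lee_fin.
have m2F : measurable_fun `[a, (a + l)%R[%classic (fun x => 2%:E * (EFin \o F) x).
  by apply: measurable_funeM; exact: mFE.
rewrite -ge0_integralD //; last by move=> x _; rewrite mule_ge0 ?lee_fin.
apply: ge0_le_integral => //.
- by apply: emeasurable_funD => //; exact: m2F.
- by move=> x; rewrite /= in_itv /= => /andP[]; exact: Fc.
Qed.

Variables t l : nat -> R.
Hypothesis l0 : forall j, (0 < l j)%R.
Hypothesis tl : forall j, (t j + l j <= t j.+1)%R.

Let I j := `[t j, (t j + l j)%R[%classic.

Lemma sample_mono i j : (i <= j)%N -> (t i <= t j)%R.
Proof.
elim: j => [|j IH]; first by rewrite leqn0 => /eqP ->.
rewrite leq_eqVlt => /orP[/eqP -> //|/IH h]; apply: (le_trans h).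
by rewrite (le_trans _ (tl j)) // lerDl ltW.
Qed.

Let trivI : trivIset setT I.
Proof.
apply: ltn_trivIset => i j ij; rewrite -subset0 => x [].
rewrite /I /= !in_itv /= => /andP[_ xj] /andP[ix _].
have := le_lt_trans (le_trans (le_trans (tl j) (sample_mono ij)) ix) xj.
by rewrite ltxx.
Qed.

Let mI j : measurable (I j). Proof. exact: measurable_itv. Qed.

Lemma esum_integral_itv :
  \esum_(j in [set: nat]) \int[mu]_(x in I j) (F x)%:E =
  \int[mu]_(x in \bigcup_j I j) (F x)%:E.
Proof.
rewrite ge0_integral_bigcup //; last 2 first.
- exact: mFE.
- by move=> x _; rewrite lee_fin.
rewrite nneseries_esumT // => n; apply: integral_ge0 => x _.
by rewrite lee_fin.
Qed.

(** The cells are disjoint and contained in the half-line, so their integrals add up to at most the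
    whole integral. Gaps between cells are allowed, which the passage from (iii) to (i) relies
    on. *)
Lemma esum_sample_le_integral (e : nat -> \bar R) : (0 <= t 0%N)%R ->
  (forall j, 0 <= e j) ->
  (forall j x, (t j <= x)%R -> (x < t j + l j)%R ->
     (F (t j))%:E <= 2%:E * (F x)%:E + e j) ->
  \esum_(j in [set: nat]) (l j * F (t j))%:E <=
    2%:E * \int[mu]_(x in `[0%R, +oo[) (F x)%:E
    + \esum_(j in [set: nat]) (e j * (l j)%:E).
Proof.
move=> t0 e0 Fe.
apply: (@le_trans _ _ (\esum_(j in [set: nat])
   (2%:E * \int[mu]_(x in I j) (F x)%:E + e j * (l j)%:E))).
  apply: le_esum => j _; apply: itv_le_integral => //; exact: Fe.
have i0 j : 0 <= \int[mu]_(x in I j) (F x)%:E.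
  by apply: integral_ge0 => x _; rewrite lee_fin.
rewrite esumD; last 2 first.
- by move=> j _; rewrite mule_ge0.
- by move=> j _; rewrite mule_ge0 // lee_fin ltW.
rewrite leeD2r // esumZl // lee_wpmul2l // esum_integral_itv.
apply: ge0_subset_integral => //.
- by apply: bigcup_measurable => j _; exact: mI.
- exact: mFE.
- by move=> x _; rewrite lee_fin.
- move=> x [j _]; rewrite /I /= !in_itv /= andbT => /andP[tx _].
  exact: le_trans (le_trans t0 (sample_mono (leq0n j))) tx.
Qed.

(** In this direction the cells have to cover the half-line: they start at 0, abut, and are
    unbounded. *)
Lemma integral_le_esum_sample (c : nat -> \bar R) : t 0%N = 0%R ->
  (forall j, t j.+1 = (t j + l j)%R) -> (forall x, exists j, (x < t j)%R) ->
  (forall j, 0 <= c j) ->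
  (forall j x, (t j <= x)%R -> (x < t j + l j)%R -> (F x)%:E <= c j) ->
  \int[mu]_(x in `[0%R, +oo[) (F x)%:E <= \esum_(j in [set: nat]) (c j * (l j)%:E).
Proof.
move=> t0 tE tub c0 Fc.
apply: (@le_trans _ _ (\int[mu]_(x in \bigcup_j I j) (F x)%:E)).
  apply: ge0_subset_integral => //.
  - by apply: bigcup_measurable => j _; exact: mI.
  - exact: mFE.
  - by move=> x _; rewrite lee_fin.
  - move=> x; rewrite /= in_itv /= andbT => x0.
    (* The cell of [x] ends at the first sample beyond [x]; this sample is not [t 0 = 0] because [x]
       is nonnegative. *)
    have [j _ /andP[tjx xtj]] : exists2 j, True & (t j <= x < t j.+1)%R.
      have ex := tub x; case: (ex_minnP ex) => -[|j] xj jmin.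
        by move: xj; rewrite t0 ltNge x0.
      exists j => //; rewrite xj andbT leNgt; apply/negP => /jmin.
      by rewrite ltnn.
    by exists j => //; rewrite /I /= in_itv /= tjx -tE.
rewrite -esum_integral_itv; apply: le_esum => j _.
by apply: integral_itv_le => //; exact: Fc.
Qed.

End IntegralSampling.

(** * A Riemann-sum bound for a decaying exponential *)

Section ExponentialSum.
Variable R : realType.

(* Each term is compared with the increment of [- exp(- b x) / b]. *)
Lemma sum_expR_sample_le (b : R) (t l : nat -> R) N : 0 < b -> 0 <= t 0%N ->
  (forall j, 0 <= l j) -> (forall j, l j <= 1) -> (forall j, t j + l j <= t j.+1) ->
  \sum_(j < N) l j * expR (- b * t j) <= expR b / b.
Proof.
move=> b0 t0 l0 l1 tl.
suff h : \sum_(j < N) l j * expR (- b * t j) <=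
    expR b / b * (expR (- b * t 0%N) - expR (- b * t N)).
  rewrite (le_trans h) // -[leRHS]mulr1; apply: ler_wpM2l.
    by rewrite divr_ge0 ?expR_ge0 // ltW.
  rewrite (@le_trans _ _ (expR (- b * t 0%N))) ?gerBl ?expR_ge0 //.
  by rewrite -expR0 ler_expR mulNr oppr_le0 mulr_ge0 // ltW.
elim: N => [|N IH]; first by rewrite big_ord0 subrr mulr0.
rewrite big_ord_recr /=.
suff : l N * expR (- b * t N) <= expR b / b * (expR (- b * t N) - expR (- b * t N.+1)).
  by move: IH; rewrite !mulrBr; lra.
have lN := tl N.
apply: (@le_trans _ _ (expR b / b * (expR (- b * t N) - expR (- b * (t N + l N))))); last first.
  apply: ler_wpM2l; first by rewrite divr_ge0 ?expR_ge0 // ltW.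
  rewrite lerB // ler_expR !mulNr lerN2 ler_wpM2l // ltW //.
have -> : expR (- b * (t N + l N)) = expR (- b * t N) * expR (- b * l N).
  by rewrite mulrDr expRD.
set X := expR (- b * t N).
have -> : expR b / b * (X - X * expR (- b * l N)) =
    expR b * (1 - expR (- b * l N)) / b * X by ring.
apply: ler_wpM2r; first exact: expR_ge0.
rewrite ler_pdivlMr //.
(* With [l = l N], the chain is [b l <= e^(bl) - 1 = e^(bl) (1 - e^(-bl)) <= e^b (1 - e^(-bl))]; the
   last step uses [l <= 1] and is the origin of the constant [expR b]. *)
have h1 := expR_ge1Dx (b * l N).
have h2 : expR (b * l N) <= expR b by rewrite ler_expR ler_piMr // ltW.
have h3 : expR (- b * l N) <= 1 by rewrite expR_le1 mulNr oppr_le0 mulr_ge0 // ltW.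
have h4 : expR (b * l N) * expR (- b * l N) = 1 by rewrite mulNr expRxMexpNx_1.
have : 0 <= (expR b - expR (b * l N)) * (1 - expR (- b * l N)) by rewrite mulr_ge0 ?subr_ge0.
lra.
Qed.

End ExponentialSum.

(** * Orbit energies: measurability, Bessel bounds and local variation *)

Section OrbitEnergy.
Variables (R : realType) (H : lmodType R[i]) (ip : H -> H -> R[i]).
Hypothesis ipA : inner_product_axioms ip.
Hypothesis Hcomplete : hcomplete ip.
Local Notation hnorm := (hnorm ip).
Variables (A : {linear H -> H}) (K : R).
Hypothesis K0 : 0 < K.
Hypothesis AK : forall x, hnorm (A x) <= K * hnorm x.
Local Notation E := (expop ip A).
Variables (G : set H) (C M b : R).
Hypotheses (C0 : 0 < C) (M0 : 0 < M) (b0 : 0 < b).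
Hypothesis GC : forall f : H,
  (\esum_(g in G) (abs2 (ip f g))%:E <= (C * hnorm f ^+ 2)%:E)%E.
Hypothesis stab : forall t f, 0 <= t ->
  hnorm (E t f) <= M * expR (- (b / 2) * t) * hnorm f.
Local Notation mu := (@lebesgue_measure R).

Definition orbit_energy (f g : H) (t : R) : R := abs2 (ip f (E t g)).
Local Notation F := orbit_energy.

Lemma orbit_energy_ge0 f g t : 0 <= F f g t.
Proof. exact: abs2_ge0. Qed.

(** Pointwise limit of the energies of the partial sums, whose inner products with [f] have real and
    imaginary parts polynomial in [t]. *)
Lemma measurable_orbit_energy f g : measurable_fun [set: R] (F f g).
Proof.
have mpart (r : H -> R) N : measurable_fun [set: R]
    (fun t : R => \sum_(n < N) (t ^+ n / n`!%:R * r (iter n A g))).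
  apply: measurable_sum => n; apply: measurable_funM; last exact: measurable_cst.
  by apply: measurable_funM; [exact: exprn_measurable | exact: measurable_cst].
apply: (@measurable_fun_cvg _ _ _ _ (fun N t => abs2 (ip f (exp_partial A t g N)))).
  move=> N; rewrite /abs2; apply: measurable_funD; apply: measurable_funX.
    rewrite (_ : (fun _ => _) = fun t => \sum_(n < N) (t ^+ n / n`!%:R *
      complex.Re (ip f (iter n A g)))); first exact: (mpart (fun x => complex.Re (ip f x))).
    apply/funext => t; rewrite (ip_sumr ipA) Re_sum; apply: eq_bigr => n _.
    by rewrite (ipZr_real ipA) Re_mulr.
  rewrite (_ : (fun _ => _) = fun t => \sum_(n < N) (t ^+ n / n`!%:R *
    complex.Im (ip f (iter n A g)))); first exact: (mpart (fun x => complex.Im (ip f x))).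
  apply/funext => t; rewrite (ip_sumr ipA) Im_sum; apply: eq_bigr => n _.
  by rewrite (ipZr_real ipA) Im_mulr.
move=> t _; apply: (cvg_abs2_ip_lim ipA).
exact: (exp_partial_cvg ipA Hcomplete (ltW K0) AK).
Qed.

(** This is [bessel_image] for the composite of [iter n A] and [E t]; the rate [b / 2] in [stab]
    becomes [b] after squaring. *)
Lemma orbit_bessel f n t : 0 <= t ->
  (\esum_(g in G) (abs2 (ip f (iter n A (E t g))))%:E <=
    (C * M ^+ 2 * hnorm f ^+ 2 * expR (- b * t) * (K ^+ n) ^+ 2)%:E)%E.
Proof.
move=> t0; have K0' := ltW K0.
have k0 : 0 <= K ^+ n * (M * expR (- (b / 2) * t)).
  by rewrite mulr_ge0 ?exprn_ge0 // mulr_ge0 ?expR_ge0 // ltW.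
apply: le_trans (bessel_image (L := fun g => iter n A (E t g)) ipA C0 GC f _ _ k0 _) _.
- by move=> x y; rewrite (expopD ipA Hcomplete K0' AK) iter_linearD.
- by move=> a x; rewrite (expopZ ipA Hcomplete K0' AK) iter_linearZ.
- move=> x; apply: le_trans (hnorm_iter_le K0' AK _ _) _.
  by rewrite -mulrA; apply: ler_wpM2l (stab _ t0); rewrite exprn_ge0.
- rewrite lee_fin !exprMn.
  have -> : expR (- (b / 2) * t) ^+ 2 = expR (- b * t).
    by rewrite -expRM_natl; congr expR; field.
  by rewrite le_eqVlt; apply/orP; left; apply/eqP; ring.
Qed.

Lemma expop_addl s t g : E (t + s) g = E s (E t g).
Proof. by rewrite addrC (expop_semigroup ipA Hcomplete (ltW K0) AK). Qed.

(** By the semigroup law, [E x g] is [E (x - t)] applied to [u = E t g], so the inner products at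
    [x] and [t] differ by a quantity that [expop_err] controls. This version bounds the integral by
    samples; the backward one bounds samples by the integral. *)
Lemma orbit_energy_forward f g h t x : t <= x -> x <= t + h ->
  ((F f g x)%:E <= 2%:E * (F f g t)%:E + 2%:E * exp_err ip A K f h (E t g))%E.
Proof.
move=> tx xth; have s0 : 0 <= x - t by rewrite subr_ge0.
have sh : x - t <= h by rewrite lerBlDl.
have e := expop_err ipA Hcomplete K0 AK f (E t g) s0 sh.
apply: (@le_trans _ _ (2%:E * (F f g t)%:E +
    2%:E * (abs2 (ip f (E (x - t) (E t g) - E t g)))%:E)%E); last first.
  by rewrite leeD2l // lee_wpmul2l.
rewrite -!EFinM -EFinD lee_fin /F.
have -> : E x g = E (x - t) (E t g) by rewrite -expop_addl subrKC.
set y := E (x - t) _; set u := E t g.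
have -> : ip f y = ip f u + ip f (y - u) by rewrite -(ipDr ipA) subrKC.
exact: abs2D_le.
Qed.

Lemma orbit_energy_backward f g h t x : t <= x -> x <= t + h ->
  ((F f g t)%:E <= 2%:E * (F f g x)%:E + 2%:E * exp_err ip A K f h (E t g))%E.
Proof.
move=> tx xth; have s0 : 0 <= x - t by rewrite subr_ge0.
have sh : x - t <= h by rewrite lerBlDl.
have e := expop_err ipA Hcomplete K0 AK f (E t g) s0 sh.
apply: (@le_trans _ _ (2%:E * (F f g x)%:E +
    2%:E * (abs2 (ip f (E (x - t) (E t g) - E t g)))%:E)%E); last first.
  by rewrite leeD2l // lee_wpmul2l.
rewrite -!EFinM -EFinD lee_fin /F.
have -> : E x g = E (x - t) (E t g) by rewrite -expop_addl subrKC.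
set y := E (x - t) _; set u := E t g.
have -> : ip f u = ip f y + - ip f (y - u) by rewrite -(ipBr ipA) subKr.
rewrite -(abs2N (ip f (y - u))); exact: abs2D_le.
Qed.

(** * Weighted samples against the integral, summed over the Bessel family *)

Section Samples.
Variables (t l : nat -> R) (h : R).
Hypotheses (t0 : 0 <= t 0%N) (l0 : forall j, 0 < l j) (lh : forall j, l j <= h).
Hypotheses (h1 : h <= 1) (tl : forall j, t j + l j <= t j.+1).

Let V (f : H) := C * M ^+ 2 * hnorm f ^+ 2.
Let Q := expR b / b.
Let l0' j : 0 <= l j. Proof. exact: ltW. Qed.
Let l1 j : l j <= 1. Proof. exact: le_trans h1. Qed.
Let h0 : 0 < h. Proof. exact: lt_le_trans (l0 0%N) _. Qed.
Let tj0 j : 0 <= t j. Proof. exact: le_trans (sample_mono l0 tl (leq0n j)). Qed.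
Let V0 f : 0 <= V f.
Proof. by rewrite mulr_ge0 ?sqr_ge0 // mulr_ge0 ?sqr_ge0 // ltW. Qed.

Lemma esum_orbit_energy_le f :
  (\esum_(g in G) \esum_(j in [set: nat]) (l j * F f g (t j))%:E <=
    (C * M ^+ 2 * (expR b / b) * hnorm f ^+ 2)%:E)%E.
Proof.
have lF0 g j : (0 <= (l j * F f g (t j))%:E)%E.
  by rewrite lee_fin mulr_ge0 ?orbit_energy_ge0.
rewrite exchange_esum //.
apply: le_esum_nat => [j|N]; first by apply: esum_ge0.
apply: (@le_trans _ _ (\sum_(j < N) (V f * (l j * expR (- b * t j)))%:E)%E).
  apply: lee_sum => j _; under eq_esum do rewrite EFinM.
  rewrite esumZl //; last by move=> g _; rewrite lee_fin orbit_energy_ge0.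
  rewrite [V f * _]mulrCA EFinM; apply: lee_wpmul2l; first by rewrite lee_fin.
  by have := orbit_bessel f 0 (tj0 j); rewrite expr0 expr1n mulr1.
rewrite sumEFin lee_fin -mulr_sumr [leRHS]mulrAC.
by apply: ler_wpM2l => //; exact: sum_expR_sample_le.
Qed.

(** At each time, [esum_exp_err] applies with [W] decaying like [expR (- b * t j)], and the times
    are then summed by [sum_expR_sample_le]. The bound is quadratic in [h] with a constant free of
    [h], which is what permits absorption later. *)
Lemma esum_orbit_err_le f :
  (\esum_(g in G) \esum_(j in [set: nat])
     (exp_err ip A K f h (E (t j) g) * (l j)%:E) <=
    ((h * (K * expR K)) ^+ 2 * (C * M ^+ 2 * (expR b / b)) * hnorm f ^+ 2)%:E)%E.
Proof.
have err0 g j : (0 <= exp_err ip A K f h (E (t j) g))%E.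
  by apply: exp_err_ge0 => //; exact: ltW.
rewrite exchange_esum; last by move=> g j; rewrite mule_ge0 // lee_fin.
apply: le_esum_nat => [j|N].
  by apply: esum_ge0 => g _; rewrite mule_ge0 // lee_fin.
apply: (@le_trans _ _ (\sum_(j < N)
    ((expR (h * K) - 1) ^+ 2 * V f * (l j * expR (- b * t j)))%:E)%E).
  apply: lee_sum => j _; under eq_esum do rewrite muleC.
  rewrite esumZl //.
  rewrite [_ * (l j * _)]mulrCA EFinM; apply: lee_wpmul2l; first by rewrite lee_fin.
  rewrite -mulrA; apply: (esum_exp_err K0 h0) => n.
  exact: orbit_bessel.
rewrite sumEFin lee_fin -mulr_sumr.
have hK0 : 0 <= h * K by rewrite mulr_ge0 // ltW.
have e0 : 0 <= expR (h * K) - 1 by rewrite subr_ge0 -[leLHS]expR0 ler_expR.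
(* From [e^(-x) >= 1 - x] one gets [e^x - 1 <= x e^x] at [x = h K], and [e^x <= e^K] because
   [h <= 1]. *)
have eh : expR (h * K) - 1 <= h * (K * expR K).
  have e1 := expR_ge1Dx (- (h * K)).
  have e2 : expR (h * K) * expR (- (h * K)) = 1 by exact: expRxMexpNx_1.
  have e3 : expR (h * K) <= expR K by rewrite ler_expR ler_piMl // ltW.
  have e4 : 0 <= expR (h * K) * (expR (- (h * K)) - (1 - h * K)).
    by rewrite mulr_ge0 ?expR_ge0 // subr_ge0.
  have e5 : 0 <= (h * K) * (expR K - expR (h * K)) by rewrite mulr_ge0 // subr_ge0.
  lra.
apply: (@le_trans _ _ ((h * (K * expR K)) ^+ 2 * V f * Q)); last first.
  by rewrite /V /Q le_eqVlt; apply/orP; left; apply/eqP; ring.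
apply: ler_pM.
- exact: mulr_ge0 (sqr_ge0 _) (V0 f).
- by apply: sumr_ge0 => j _; rewrite mulr_ge0 ?expR_ge0.
- apply: ler_wpM2r => //; apply: lerXn2r; rewrite ?nnegrE //.
  exact: le_trans eh.
- exact: sum_expR_sample_le.
Qed.

Lemma esum_samples_le_integral f :
  (\esum_(g in G) \esum_(j in [set: nat]) (l j * F f g (t j))%:E <=
   2%:E * (\esum_(g in G) \int[mu]_(x in `[0%R, +oo[) (F f g x)%:E) +
   (2 * ((h * (K * expR K)) ^+ 2 * (C * M ^+ 2 * (expR b / b)) * hnorm f ^+ 2))%:E)%E.
Proof.
have err0 g j : (0 <= exp_err ip A K f h (E (t j) g))%E.
  by apply: exp_err_ge0 => //; exact: ltW.
have i0 g : (0 <= \int[mu]_(x in `[0%R, +oo[) (F f g x)%:E)%E.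
  by apply: integral_ge0 => x _; rewrite lee_fin orbit_energy_ge0.
have le0 g j : (0 <= exp_err ip A K f h (E (t j) g) * (l j)%:E)%E.
  by rewrite mule_ge0 // lee_fin.
apply: (@le_trans _ _ (\esum_(g in G) (2%:E * \int[mu]_(x in `[0%R, +oo[) (F f g x)%:E +
   2%:E * \esum_(j in [set: nat]) (exp_err ip A K f h (E (t j) g) * (l j)%:E)))%E).
  apply: le_esum => g _; rewrite -esumZl //.
  under [X in (_ + X)%E]eq_esum do rewrite muleA.
  apply: esum_sample_le_integral => //.
  - exact: orbit_energy_ge0.
  - exact: measurable_orbit_energy.
  - by move=> j; rewrite mule_ge0.
  - move=> j x tx xt; apply: orbit_energy_backward => //.
    by rewrite (le_trans (ltW xt)) // lerD2l.
rewrite esumD; last 2 first.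
- by move=> g _; rewrite mule_ge0.
- by move=> g _; rewrite mule_ge0 // esum_ge0.
rewrite esumZl // esumZl //; last by move=> g _; rewrite esum_ge0.
rewrite leeD2l // EFinM lee_wpmul2l //.
exact: esum_orbit_err_le.
Qed.

Lemma integral_le_esum_samples f : t 0%N = 0 -> (forall j, t j.+1 = t j + l j) ->
  (forall x, exists j, x < t j) ->
  (\esum_(g in G) \int[mu]_(x in `[0%R, +oo[) (F f g x)%:E <=
   2%:E * (\esum_(g in G) \esum_(j in [set: nat]) (l j * F f g (t j))%:E) +
   (2 * ((h * (K * expR K)) ^+ 2 * (C * M ^+ 2 * (expR b / b)) * hnorm f ^+ 2))%:E)%E.
Proof.
move=> t00 tE tub.
have err0 g j : (0 <= exp_err ip A K f h (E (t j) g))%E.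
  by apply: exp_err_ge0 => //; exact: ltW.
have le0 g j : (0 <= exp_err ip A K f h (E (t j) g) * (l j)%:E)%E.
  by rewrite mule_ge0 // lee_fin.
have lF0 g j : (0 <= (l j * F f g (t j))%:E)%E.
  by rewrite lee_fin mulr_ge0 ?orbit_energy_ge0.
apply: (@le_trans _ _ (\esum_(g in G) (
   2%:E * (\esum_(j in [set: nat]) (l j * F f g (t j))%:E) +
   2%:E * \esum_(j in [set: nat]) (exp_err ip A K f h (E (t j) g) * (l j)%:E)))%E).
  apply: le_esum => g _; rewrite -!esumZl //.
  rewrite -esumD; last 2 first.
  - by move=> j _; rewrite mule_ge0.
  - by move=> j _; rewrite mule_ge0.
  apply: (@le_trans _ _ (\esum_(j in [set: nat]) ((2%:E * (F f g (t j))%:E +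
      2%:E * exp_err ip A K f h (E (t j) g)) * (l j)%:E))%E); last first.
    apply: le_esum => j _; rewrite ge0_muleDl; last 2 first.
    - by rewrite mule_ge0 // lee_fin orbit_energy_ge0.
    - by rewrite mule_ge0.
    by rewrite -!muleA leeD2r // -EFinM [l j * _]mulrC.
  apply: integral_le_esum_sample => //.
  - exact: orbit_energy_ge0.
  - exact: measurable_orbit_energy.
  - by move=> j; rewrite adde_ge0 // mule_ge0 // lee_fin orbit_energy_ge0.
  - move=> j x tx xt; apply: orbit_energy_forward => //.
    by rewrite (le_trans (ltW xt)) // lerD2l.
rewrite esumD; last 2 first.
- by move=> g _; rewrite mule_ge0 // esum_ge0.
- by move=> g _; rewrite mule_ge0 // esum_ge0.
rewrite esumZl //; last by move=> g _; rewrite esum_ge0.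
rewrite esumZl //; last by move=> g _; rewrite esum_ge0.
rewrite leeD2l // EFinM lee_wpmul2l //.
exact: esum_orbit_err_le.
Qed.

End Samples.

(** [orbit_frame] sums over a set of times; injectivity of [t] lets the indices replace the times
    without repetition. *)
Lemma esum_orbit_frame (t : nat -> R) (f : H) : injective t ->
  \esum_(p in [set p : H * R | G p.1 /\ range t p.2]) (abs2 (ip f (E p.2 p.1)))%:E =
  \esum_(g in G) \esum_(j in [set: nat]) (F f g (t j))%:E.
Proof.
move=> tinj.
have -> : [set p : H * R | G p.1 /\ range t p.2] = G `*`` (fun=> range t).
  by apply/seteqP; split.
rewrite -(@esum_esum _ _ _ G (fun=> range t) (fun g s => (F f g s)%:E)); last first.
  by move=> g s _ _; rewrite lee_fin orbit_energy_ge0.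
apply: eq_esum => g _; rewrite (reindex_esum [set: nat] (range t) t) //.
by split=> [j _|i j _ _ /tinj //|//]; exists j.
Qed.

End OrbitEnergy.

(** * Regular grids of times and finiteness of sums *)

Lemma range_natmul (R : realType) (m : R) :
  [set s : R | exists j : nat, s = j%:R * m] = range (fun j : nat => j%:R * m).
Proof.
by apply/seteqP; split=> s /=; [move=> [j ->]; exists j | move=> [j _ <-]; exists j].
Qed.

Lemma natmul_inj (R : realType) (m : R) : 0 < m -> injective (fun j : nat => j%:R * m).
Proof. by move=> m0 i j /(mulIf (lt0r_neq0 m0)) /eqP; rewrite eqr_nat => /eqP. Qed.

Lemma natmul_unbounded (R : realType) (m : R) (x : R) : 0 < m ->
  exists j : nat, x < j%:R * m.
Proof.
move=> m0; exists (Num.truncn (x / m)).+1.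
by rewrite -ltr_pdivrMr // truncnS_gt.
Qed.

Lemma esum_esumZl (R : realType) (T T' : choiceType) (I : set T) (J : set T') (k : R)
    (F : T -> T' -> R) : 0 < k -> (forall i j, 0 <= F i j) ->
  (\esum_(i in I) \esum_(j in J) (k * F i j)%:E =
   k%:E * \esum_(i in I) \esum_(j in J) (F i j)%:E)%E.
Proof.
move=> k0 F0; rewrite -esumZl //; last first.
  by move=> i _; apply: esum_ge0 => j _; rewrite lee_fin.
apply: eq_esum => i _; rewrite -esumZl // => j _; rewrite lee_fin //.
Qed.

Lemma ereal_between_fin (R : realType) (x : \bar R) (r : R) :
  (0 <= x)%E -> (x <= r%:E)%E -> exists y : R, x = y%:E.
Proof. by case: x => // y _ _; exists y. Qed.

(** * Equivalence of continuous, dense and regular sampling in time *)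

Theorem mainTheorem2 (R : realType) (H : lmodType R[i]) (ip : H -> H -> R[i])
  (hH : is_separable_hilbert ip) (A : {linear H -> H})
  (hA : bounded_op ip A) (G : set H) (hGc : countable G)
  (hGb : bessel_system ip G) (hstab : exp_stable ip A) :
  (semi_continuous_frame ip A G <->
     exists delta : R, 0 < delta /\
       forall t : nat -> R,
         t 0%N = 0 ->
         (forall j : nat, 0 < t j.+1 - t j /\ t j.+1 - t j < delta) ->
         uniformly_separated (range t) ->
         orbit_frame ip A G (range t))
  /\
  (semi_continuous_frame ip A G <->
     exists m : R, 0 < m /\
       orbit_frame ip A G [set s : R | exists j : nat, s = j%:R * m]).
Proof.
case: hH => ipA Hcomplete _.
(* The bound is made positive because [exp_err] divides by powers of [K]. *)
have [K [K0 AK]] : exists K : R, 0 < K /\ forall x, hnorm ip (A x) <= K * hnorm ip x.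
  have [K AK] := hA; exists (`|K| + 1); split; first by rewrite ltr_wpDl.
  move=> x; apply: (le_trans (AK x)); apply: ler_wpM2r; first exact: hnorm_ge0.
  by rewrite (le_trans (ler_norm K)) // lerDl.
have [C [C0 GC]] := hGb.
have [M [w [M1 [w0 stab]]]] := hstab.
have M0 : 0 < M by exact: lt_le_trans M1.
pose b := - (2 * w).
have b0 : 0 < b by rewrite oppr_gt0 pmulr_rlt0.
have {}stab t f : 0 <= t ->
    hnorm ip (expop ip A t f) <= M * expR (- (b / 2) * t) * hnorm ip f.
  by have -> : - (b / 2) = w; [rewrite /b; field | move=> /stab].
(* Relative to [|f|^2], the weighted samples are at most [S] and the comparison error at mesh [h] is
   at most [h^2 D]; both constants are independent of the sampling times. *)
pose S := C * M ^+ 2 * (expR b / b).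
have S0 : 0 < S by rewrite /S mulr_gt0 ?divr_gt0 ?expR_gt0 // mulr_gt0 ?exprn_gt0.
pose D := 2 * ((K * expR K) ^+ 2 * S).
have D0 : 0 < D.
  by rewrite /D mulr_gt0 // mulr_gt0 // exprn_gt0 // mulr_gt0 ?expR_gt0.
have DE h f : 2 * ((h * (K * expR K)) ^+ 2 * S * hnorm ip f ^+ 2) =
    h ^+ 2 * D * hnorm ip f ^+ 2 by rewrite /D; ring.
pose F f g t := orbit_energy ip A f g t.
have F0 f g t : 0 <= F f g t by exact: orbit_energy_ge0.
pose I f := (\esum_(g in G) \int[lebesgue_measure]_(x in `[0%R, +oo[) (F f g x)%:E)%E.
pose X (t : nat -> R) f := (\esum_(g in G) \esum_(j in [set: nat]) (F f g (t j))%:E)%E.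
have I0 f : (0 <= I f)%E.
  by apply: esum_ge0 => g _; apply: integral_ge0 => x _; rewrite lee_fin.
have X0 t f : (0 <= X t f)%E.
  by apply: esum_ge0 => g _; apply: esum_ge0 => j _; rewrite lee_fin.
(* Upper frame bound: all weights are taken equal to a lower bound [e] of the gaps, and the weighted
   estimate is divided by [e] once the sum is known to be finite. *)
have X_le t e f : 0 <= t 0%N -> 0 < e -> (forall j, t j + e <= t j.+1) ->
    e <= 1 -> (X t f <= (S / e * hnorm ip f ^+ 2)%:E)%E.
  move=> t0 e0 te e1.
  have := esum_orbit_energy_le ipA Hcomplete K0 AK C0 M0 b0 GC stab t0 (fun=> e0)
    (fun=> lexx e) e1 te f.
  rewrite esum_esumZl // -/(X t f) => h.
  have [x xE] : exists x, X t f = x%:E.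
    move: h (X0 t f); case: (X t f) => [x _ _|h _|//]; first by exists x.
    by move: h; rewrite gt0_muley ?lte_fin.
  move: h; rewrite xE -EFinM !lee_fin => h.
  by rewrite mulrAC ler_pdivlMr // mulrC.
(* The integral is compared with samples at the nonnegative integers, that is, with mesh 1. *)
have I_le f : (I f <= ((2 * S + D) * hnorm ip f ^+ 2)%:E)%E.
  pose t j : R := j%:R * 1.
  have t0 : 0 <= t 0%N by rewrite /t mul0r.
  have tS j : t j.+1 = t j + 1 by rewrite /t !mulr1 -natr1.
  have tl j : t j + 1 <= t j.+1 by rewrite tS.
  have := integral_le_esum_samples ipA Hcomplete K0 AK C0 M0 b0 GC stab t0 (fun=> ltr01)
    (fun=> lexx 1) (lexx 1) tl f (mul0r _) tS (fun x => natmul_unbounded x ltr01).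
  have := esum_orbit_energy_le ipA Hcomplete K0 AK C0 M0 b0 GC stab t0 (fun=> ltr01)
    (fun=> lexx 1) (lexx 1) tl f.
  rewrite -/S DE expr1n mul1r => h1 h2; apply: (le_trans h2).
  rewrite [(2 * S + D) * _]mulrDl [leRHS]EFinD; apply: leeD2r; rewrite -mulrA EFinM.
  by apply: lee_wpmul2l => //; rewrite lee_fin.
have i_to_ii : semi_continuous_frame ip A G -> exists delta : R, 0 < delta /\
    forall t : nat -> R, t 0%N = 0 ->
      (forall j : nat, 0 < t j.+1 - t j /\ t j.+1 - t j < delta) ->
      uniformly_separated (range t) -> orbit_frame ip A G (range t).
  move=> [c [C1 [c0 [_ If]]]].
  (* Since [d <= 1], the error [d^2 D] is at most [d D <= c / 2], half of the lower frame bound. *)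
  pose d := Num.min 1 (c / (2 * D)).
  have d0 : 0 < d by rewrite /d lt_min ltr01 /= divr_gt0 // mulr_gt0.
  have d1 : d <= 1 by rewrite /d ge_min lexx.
  have dD : d * D <= c / 2.
    have : d <= c / (2 * D) by rewrite /d ge_min lexx orbT.
    by rewrite invfM mulrA -ler_pdivlMr.
  exists d; split=> // t t0 gap [e' [e'0 sep]].
  have t0' : 0 <= t 0%N by rewrite t0.
  pose l j := t j.+1 - t j.
  have l0 j : 0 < l j by case: (gap j).
  have ld j : l j <= d by apply: ltW; case: (gap j).
  have tS j : t j.+1 = t j + l j by rewrite /l subrKC.
  have tl j : t j + l j <= t j.+1 by rewrite tS.
  have tlt i j : (i < j)%N -> t i < t j.
    by move=> ij; apply: lt_le_trans (sample_mono l0 tl ij); rewrite tS ltrDl.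
  have tinj : injective t.
    move=> i j tij; apply/eqP; case: (ltngtP i j) => // /tlt; by rewrite tij ltxx.
  (* The separation constant is capped at 1, as [X_le] demands. The resulting [j e <= t j] also
     shows that the times are unbounded. *)
  pose e := Num.min e' 1.
  have e0 : 0 < e by rewrite /e lt_min e'0 ltr01.
  have e1 : e <= 1 by rewrite /e ge_min lexx orbT.
  have el j : e <= l j.
    rewrite /e ge_min; apply/orP; left.
    have := sep (t j.+1) (t j); rewrite (gtr0_norm (l0 j)); apply.
    - by exists j.+1.
    - by exists j.
    - by move=> /tinj /eqP; rewrite -[X in _ == X]addn0 -addn1 eqn_add2l.
  have te j : t j + e <= t j.+1 by rewrite tS lerD2l.
  have tub x : exists j, x < t j.
    have [j xj] := natmul_unbounded x e0; exists j; apply: lt_le_trans xj _.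
    elim: j => [|j IH]; first by rewrite mul0r.
    by rewrite (le_trans _ (te j)) // -natr1 mulrDl mul1r lerD2r.
  (* Weights are at most [d], so [c |f|^2 <= 2 d X + (c / 2) |f|^2], with [X] the sum of the
     samples. *)
  exists (c / (4 * d)), (S / e); split; first by rewrite divr_gt0 // mulr_gt0.
  split; first by rewrite divr_gt0.
  move=> f; rewrite (esum_orbit_frame _ _ _ _ tinj) -/(X t f).
  have XS := X_le t e f t0' e0 te e1; split => //.
  have [x xE] := ereal_between_fin (X0 t f) XS.
  have [y yE] := ereal_between_fin (I0 f) (I_le f).
  have [If1 _] := If f.
  have := integral_le_esum_samples ipA Hcomplete K0 AK C0 M0 b0 GC stab t0' l0
    ld d1 tl f t0 tS tub.
  rewrite -/(I f) -/S DE yE.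
  set L := \esum_(g in G) _ => IL.
  have LX : (L <= (d * x)%:E)%E.
    rewrite EFinM -xE -esum_esumZl //; apply: le_esum => g _; apply: le_esum => j _.
    by rewrite lee_fin ler_wpM2r.
  have {IL} : (y%:E <= (2 * (d * x) + d ^+ 2 * D * hnorm ip f ^+ 2)%:E)%E.
    apply: (le_trans IL); rewrite [leRHS]EFinD; apply: leeD2r.
    by rewrite [leRHS]EFinM; apply: lee_wpmul2l.
  have : ((c * hnorm ip f ^+ 2)%:E <= y%:E)%E by rewrite -yE.
  rewrite xE !lee_fin => h1 h2.
  have n0 : 0 <= hnorm ip f ^+ 2 by exact: sqr_ge0.
  have h3 : d ^+ 2 * D * hnorm ip f ^+ 2 <= c / 2 * hnorm ip f ^+ 2.
    apply: ler_wpM2r => //; apply: le_trans dD.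
    by rewrite expr2 -mulrA ler_piMl // mulr_ge0 // ltW.
  rewrite mulrAC ler_pdivrMr ?mulr_gt0 //; lra.
have ii_to_iii : (exists delta : R, 0 < delta /\
    forall t : nat -> R, t 0%N = 0 ->
      (forall j : nat, 0 < t j.+1 - t j /\ t j.+1 - t j < delta) ->
      uniformly_separated (range t) -> orbit_frame ip A G (range t)) ->
    exists m : R, 0 < m /\ orbit_frame ip A G [set s : R | exists j : nat, s = j%:R * m].
  move=> [d [d0 fr]]; have m0 : 0 < d / 2 by rewrite divr_gt0.
  (* Half of [d] keeps the gaps strictly below [d]. *)
  exists (d / 2); split => //; rewrite range_natmul; apply: fr; first by rewrite mul0r.
    move=> j; rewrite -mulrBl -natr1 addrC addKr mul1r; split => //; lra.
  exists (d / 2); split => // s s' [i _ <-] [j _ <-] ij.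
  rewrite -mulrBl normrM (gtr0_norm m0) ler_peMl ?(ltW m0) //.
  have nij : i != j by apply/eqP => ijE; apply: ij; rewrite ijE.
  case: (ltngtP i j) nij => // lt_ij _.
    by rewrite distrC -natrB ?(ltnW lt_ij) // normr_nat ler1n subn_gt0.
  by rewrite -natrB ?(ltnW lt_ij) // normr_nat ler1n subn_gt0.
have iii_to_i : (exists m : R, 0 < m /\
    orbit_frame ip A G [set s : R | exists j : nat, s = j%:R * m]) ->
    semi_continuous_frame ip A G.
  move=> [m [m0]]; rewrite range_natmul => -[c [C1 [c0 [_ Xf]]]].
  pose t j : R := j%:R * m.
  (* [h <= m] keeps the cells starting at [j m] disjoint, and [h D <= c / 2] makes the error [h^2 D]
     at most half of the main term [h c]. *)
  pose h := Num.min (Num.min 1 m) (c / (2 * D)).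
  have h0 : 0 < h by rewrite /h !lt_min ltr01 m0 /= divr_gt0 // mulr_gt0.
  have h1 : h <= 1 by rewrite /h !ge_min lexx.
  have hm : h <= m by rewrite /h !ge_min lexx orbT.
  have hD : h * D <= c / 2.
    have : h <= c / (2 * D) by rewrite /h ge_min lexx orbT.
    by rewrite invfM mulrA -ler_pdivlMr.
  have t0 : 0 <= t 0%N by rewrite /t mul0r.
  have tl j : t j + h <= t j.+1 by rewrite /t -natr1 mulrDl mul1r lerD2l.
  (* The lower bound comes from [h c |f|^2 <= h X <= 2 I + (h c / 2) |f|^2], with [X] the sum of the
     samples and [I] the integral energy. *)
  exists (h * c / 4), (2 * S + D); split; first by rewrite divr_gt0 // mulr_gt0.
  split; first by rewrite addr_gt0 // mulr_gt0.
  move=> f; split; last exact: I_le.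
  have [y yE] := ereal_between_fin (I0 f) (I_le f).
  have [x xE] := ereal_between_fin (X0 t f) (X_le t h f t0 h0 tl h1).
  have [] := Xf f; rewrite (esum_orbit_frame _ _ _ _ (natmul_inj m0)) -/(X t f) xE.
  rewrite lee_fin => cx _.
  have := esum_samples_le_integral ipA Hcomplete K0 AK C0 M0 b0 GC stab t0 (fun=> h0)
    (fun=> lexx h) h1 tl f.
  rewrite esum_esumZl // -/(X t f) -/(I f) -/S DE xE yE -!EFinM -EFinD !lee_fin => hx.
  have n0 : 0 <= hnorm ip f ^+ 2 by exact: sqr_ge0.
  have h3 : h ^+ 2 * D * hnorm ip f ^+ 2 <= h * (c / 2) * hnorm ip f ^+ 2.
    by apply: ler_wpM2r => //; rewrite expr2 -mulrA ler_wpM2l // ltW.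
  have h4 : h * (c * hnorm ip f ^+ 2) <= h * x by rewrite ler_wpM2l // ltW.
  lra.
by split; split=> [fr|fr]; auto.
Qed.
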